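(* Let $\psi$, $f$, $I$, $p$ be as in the context, and consider the linear second-order PDE for a function $\xi(H,r)$ on a domain in $\mathbb{R}\times I$: $$\frac{\partial^{2}\xi}{\partial H^{2}}+\frac{1}{p(r)}\frac{\partial}{\partial r}\Big(p(r)\frac{\partial \xi}{\partial r}\Big)=0. \qquad (3)$$ (a) Suppose $\xi_1,\xi_2$ are solutions of (3) near a point $(H_0,r_0)$ and that the Jacobian determinant $\det\big(\partial(\xi_1,\xi_2)/\partial(H,r)\big)$ is positive at $(H_0,r_0)$. Define the 1-forms $$\epsilon_1=p(r)\Big(\frac{\partial\xi_2}{\partial r}\,dH-\frac{\partial\xi_2}{\partial H}\,dr\Big),\quad \epsilon_2=p(r)\Big(-\frac{\partial\xi_1}{\partial r}\,dH+\frac{\partial\xi_1}{\partial H}\,dr\Big),\quad \epsilon=\xi_1\epsilon_1+\xi_2\epsilon_2.$$ Then $\epsilon,\epsilon_1,\epsilon_2$ are closed and $\epsilon_1\wedge\epsilon_2$ is nonvanishing near $(H_0,r_0)$. Hence locally there are functions $u,x_1,x_2$ with $du=\epsilon$, $dx_1=\epsilon_1$, $dx_2=\epsilon_2$, and $(x_1,x_2)$ are local coordinates near $(H_0,r_0)$. Regarding $u$ as a function of $(x_1,x_2)$ on a suitable domain, $u$ is a solution of equation (2) (with $n=2$), $\partial u/\partial x_i=\xi_i$, and every point of this domain is an ordinary point. (b) Conversely, let $u$ be a (strictly) convex solution of (2) with $n=2$ near an ordinary point. Then, in a neighbourhood of that point, $u$ arises by the construction in (a): there are local coordinates $(H,r)$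 with $r=f(J)$ and solutions $\xi_1,\xi_2$ of (3) (namely $\xi_i=\partial u/\partial x_i$ expressed in the coordinates $(H,r)$) with $\det(\partial(\xi_1,\xi_2)/\partial(H,r))>0$, such that $u,x_1,x_2$ are recovered from $\xi_1,\xi_2$ as in (a) up to additive constants. The solutions $\xi_1,\xi_2$ are unique up to translation in the variable $H$ and the addition of constants.
   Context: Let $\psi$ be a smooth, strictly convex function on $(0,\infty)$. For a strictly convex function $u(x_1,\dots,x_n)$ on a domain in $\mathbb{R}^n$ write $u_{ij}=\partial^2u/\partial x_i\partial x_j$, $J=\det(u_{ij})>0$, and $(u^{ij})$ for the inverse matrix of $(u_{ij})$. Equation (2) is the fourth-order PDE $$\sum_{i,j}\frac{\partial^{2}}{\partial x_i\partial x_j}\big(J\psi'(J)u^{ij}\big)=0$$ (the Euler–Lagrange equation of $\int\psi(J)\,dx$). A point is an ordinary point of $u$ if $\nabla J\neq 0$ there. Let $f$ be a solution of $f'(t)=t^{1/2}\psi''(t)$ on $(0,\infty)$; then $f$ is strictly increasing and maps $(0,\infty)$ bijectively onto an interval $I$. Define $p:I\to(0,\infty)$ by $p(r)=\big(f^{-1}(r)\big)^{-1/2}$, i.e. $J^{-1/2}=p(r)$ when $r=f(J)$. *)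

(* Defs.v *)
From Stdlib Require Import Reals Lra ClassicalEpsilon.
Open Scope R_scope.

(* The derivative of g at t (when it exists; unique by uniqueness of limits). *)
Definition der (g : R -> R) (t : R) : R :=
  epsilon (inhabits 0) (fun l => derivable_pt_lim g t l).

Definition pd1 (g : R -> R -> R) (x y : R) : R := der (fun t => g t y) x.
Definition pd2 (g : R -> R -> R) (x y : R) : R := der (fun t => g x t) y.

Definition open1 (A : R -> Prop) : Prop :=
  forall t, A t -> exists d, 0 < d /\ forall t', Rabs (t' - t) < d -> A t'.

Definition open2 (U : R -> R -> Prop) : Prop :=
  forall x y, U x y -> exists d, 0 < d /\
    forall x' y', Rabs (x' - x) < d -> Rabs (y' - y) < d -> U x' y'.

Definition cont1_on (A : R -> Prop) (g : R -> R) : Prop :=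
  forall t, A t -> continuity_pt g t.

Definition cont2_on (U : R -> R -> Prop) (g : R -> R -> R) : Prop :=
  forall x y, U x y -> forall e, 0 < e -> exists d, 0 < d /\
    forall x' y', Rabs (x' - x) < d -> Rabs (y' - y) < d ->
      Rabs (g x' y' - g x y) < e.

Definition has_pd_on (U : R -> R -> Prop) (g : R -> R -> R) : Prop :=
  forall x y, U x y ->
    (exists l, derivable_pt_lim (fun t => g t y) x l) /\
    (exists l, derivable_pt_lim (fun t => g x t) y l).

Fixpoint Ck1 (A : R -> Prop) (k : nat) (g : R -> R) : Prop :=
  match k with
  | O => cont1_on A g
  | S k' => cont1_on A g /\ (forall t, A t -> exists l, derivable_pt_lim g t l)
            /\ Ck1 A k' (der g)
  end.

Fixpoint Ck2 (U : R -> R -> Prop) (k : nat) (g : R -> R -> R) : Prop :=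
  match k with
  | O => cont2_on U g
  | S k' => cont2_on U g /\ has_pd_on U g /\ Ck2 U k' (pd1 g) /\ Ck2 U k' (pd2 g)
  end.

Definition smooth1 (A : R -> Prop) (g : R -> R) : Prop := forall k, Ck1 A k g.
Definition smooth2 (U : R -> R -> Prop) (g : R -> R -> R) : Prop := forall k, Ck2 U k g.

Definition Jdet (u : R -> R -> R) (x y : R) : R :=
  pd1 (pd1 u) x y * pd2 (pd2 u) x y - pd2 (pd1 u) x y * pd1 (pd2 u) x y.

(* strict convexity on a (not necessarily convex) domain V:
   strict convexity inequality along every segment contained in V *)
Definition strictly_convex_on (V : R -> R -> Prop) (u : R -> R -> R) : Prop :=
  forall a1 a2 b1 b2, (a1 <> b1 \/ a2 <> b2) ->
    (forall l, 0 <= l <= 1 -> V (l * a1 + (1 - l) * b1) (l * a2 + (1 - l) * b2)) ->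
    forall l, 0 < l < 1 ->
      u (l * a1 + (1 - l) * b1) (l * a2 + (1 - l) * b2) < l * u a1 a2 + (1 - l) * u b1 b2.

(* sum_{i,j} d^2/dx_i dx_j ( J psi'(J) u^{ij} ) = 0 on V, where (u^{ij}) = (u_ij)^{-1} *)
Definition eq2 (psi : R -> R) (V : R -> R -> Prop) (u : R -> R -> R) : Prop :=
  let J := Jdet u in
  let W11 := fun x y => J x y * der psi (J x y) * (pd2 (pd2 u) x y / J x y) in
  let W12 := fun x y => J x y * der psi (J x y) * (- pd2 (pd1 u) x y / J x y) in
  let W21 := fun x y => J x y * der psi (J x y) * (- pd1 (pd2 u) x y / J x y) in
  let W22 := fun x y => J x y * der psi (J x y) * (pd1 (pd1 u) x y / J x y) in
  forall x y, V x y ->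
    pd1 (pd1 W11) x y + pd1 (pd2 W12) x y + pd2 (pd1 W21) x y + pd2 (pd2 W22) x y = 0.

Definition sol2 (psi : R -> R) (V : R -> R -> Prop) (u : R -> R -> R) : Prop :=
  open2 V /\ smooth2 V u /\ strictly_convex_on V u /\
  (forall x y, V x y -> 0 < Jdet u x y) /\ eq2 psi V u.

Definition ordinary (u : R -> R -> R) (x y : R) : Prop :=
  pd1 (Jdet u) x y <> 0 \/ pd2 (Jdet u) x y <> 0.

Definition eq3 (p : R -> R) (Om : R -> R -> Prop) (xi : R -> R -> R) : Prop :=
  smooth2 Om xi /\
  forall H r, Om H r ->
    pd1 (pd1 xi) H r + / p r * pd2 (fun H' r' => p r' * pd2 xi H' r') H r = 0.

Definition Jac (xi1 xi2 : R -> R -> R) (H r : R) : R :=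
  pd1 xi1 H r * pd2 xi2 H r - pd2 xi1 H r * pd1 xi2 H r.

(* ---------- 1-forms a dH + b dr, represented by (a, b) ---------- *)
Definition form := ((R -> R -> R) * (R -> R -> R))%type.

Definition eps1f (p : R -> R) (xi2 : R -> R -> R) : form :=
  (fun H r => p r * pd2 xi2 H r, fun H r => - (p r * pd1 xi2 H r)).
Definition eps2f (p : R -> R) (xi1 : R -> R -> R) : form :=
  (fun H r => - (p r * pd2 xi1 H r), fun H r => p r * pd1 xi1 H r).
Definition epsf (p : R -> R) (xi1 xi2 : R -> R -> R) : form :=
  (fun H r => xi1 H r * fst (eps1f p xi2) H r + xi2 H r * fst (eps2f p xi1) H r,
   fun H r => xi1 H r * snd (eps1f p xi2) H r + xi2 H r * snd (eps2f p xi1) H r).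

Definition closed_on (Om : R -> R -> Prop) (w : form) : Prop :=
  has_pd_on Om (fst w) /\ has_pd_on Om (snd w) /\
  forall H r, Om H r -> pd2 (fst w) H r = pd1 (snd w) H r.

Definition wedge_nonvanishing (Om : R -> R -> Prop) (w1 w2 : form) : Prop :=
  forall H r, Om H r -> fst w1 H r * snd w2 H r - snd w1 H r * fst w2 H r <> 0.

Definition dprim (Om : R -> R -> Prop) (g : R -> R -> R) (w : form) : Prop :=
  forall H r, Om H r ->
    derivable_pt_lim (fun t => g t r) H (fst w H r) /\
    derivable_pt_lim (fun t => g H t) r (snd w H r).

Definition diffeo (A B : R -> R -> Prop) (x1 x2 y1 y2 : R -> R -> R) : Prop :=
  open2 A /\ open2 B /\
  smooth2 A x1 /\ smooth2 A x2 /\ smooth2 B y1 /\ smooth2 B y2 /\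
  (forall a b, A a b -> B (x1 a b) (x2 a b) /\
                        y1 (x1 a b) (x2 a b) = a /\ y2 (x1 a b) (x2 a b) = b) /\
  (forall c d, B c d -> A (y1 c d) (y2 c d) /\
                        x1 (y1 c d) (y2 c d) = c /\ x2 (y1 c d) (y2 c d) = d).

Definition subset2 (A B : R -> R -> Prop) : Prop := forall a b, A a b -> B a b.

(* Main.v *)
Require Import Defs.
From Stdlib Require Import Reals Lra Lia ClassicalEpsilon.
From Coquelicot Require Import Coquelicot.
Open Scope R_scope.

(** Write J = det (u_ij) and r = f(J). Since the cofactor matrix of the Hessian is
    divergence free, equation (2) says that the vector field with components
    p(r) (r_1 u_22 - r_2 u_12) and p(r) (r_2 u_11 - r_1 u_12) is divergence free, where
    psi''(J) dJ = p(r) dr because f' = t^(1/2) psi''. Locally this field is (- H_2, H_1)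
    for a function H, unique up to a constant, and the Jacobian of (H, r) is p(r) times
    the cofactor quadratic form at grad r, hence positive at ordinary points. In the
    coordinates (H, r) the identity p(r)^2 J = 1 turns the definition of H into
    dx_1 = eps_1 and dx_2 = eps_2 with xi_i = u_i, whose closedness is equation (3).
    Conversely dx_i = eps_i gives J = 1 / p(r)^2, that is r = f(J), and the vector field
    above is again (- H_2, H_1), so that (2) is the symmetry of second derivatives of H. *)

(** * Derivatives and partial derivatives *)

(** The passage to (H, r) is a hodograph transformation: a nonlinear fourth-order equation becomes
    linear once H and r are the independent variables and x_1, x_2 the unknowns. If star denotes the
    flat Hodge star in (H, r), then eps_1 = - p star(d xi_2) and eps_2 = p star(d xi_1), so both
    closedness conditions are the same weighted Laplace equation, which is (3). Since [der] is a
    choice operator, a derivative can be used only after it is known to exist, and an equality can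
    be differentiated only where it holds on an open set. The working notion is therefore
    [dprim U g w], which exhibits both partial derivatives of g on U. Two analytic tools carry the
    local constructions: the Poincaré lemma, which produces H, u, x_1, x_2, and the inverse function
    theorem with a smooth inverse, which makes (H, r) or (x_1, x_2) coordinates. Smoothness of f and
    p is derived: that of f from the formula for f', that of p by inverting f. *)

Lemma der_eq g t l : derivable_pt_lim g t l -> der g t = l.
Proof.
  intros Hl.
  apply (uniqueness_limite g t); [|exact Hl].
  unfold der; apply epsilon_spec; exists l; exact Hl.
Qed.

Lemma der_spec g t :
  (exists l, derivable_pt_lim g t l) -> derivable_pt_lim g t (der g t).
Proof. intros [l Hl]; rewrite (der_eq _ _ _ Hl); exact Hl. Qed.

Lemma derivable_pt_lim_ext_loc g h t l d :
  0 < d -> (forall s, Rabs (s - t) < d -> g s = h s) ->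
  derivable_pt_lim g t l -> derivable_pt_lim h t l.
Proof.
  intros Hd E Hg; apply is_derive_Reals.
  apply (is_derive_ext_loc g); [|apply is_derive_Reals; exact Hg].
  exists (mkposreal d Hd); intros s Hs; apply E; exact Hs.
Qed.

Lemma derivable_pt_lim_value g t l m :
  derivable_pt_lim g t l -> l = m -> derivable_pt_lim g t m.
Proof. intros H <-; exact H. Qed.

Lemma MVT_segment g dg a b :
  (forall x, Rmin a b <= x <= Rmax a b -> derivable_pt_lim g x (dg x)) ->
  exists c, Rmin a b <= c <= Rmax a b /\ g b - g a = dg c * (b - a).
Proof.
  intros Hg; apply (MVT_gen g a b dg).
  - intros x Hx; apply is_derive_Reals, Hg; lra.
  - intros x Hx; apply derivable_continuous_pt; exists (dg x); apply Hg, Hx.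
Qed.

Lemma Rabs_between a b c d :
  Rmin a b <= c <= Rmax a b -> Rabs (b - a) < d -> Rabs (c - a) < d.
Proof.
  unfold Rmin, Rmax; destruct (Rle_dec a b); intros Hc Hd;
  revert Hd; unfold Rabs; repeat destruct Rcase_abs; lra.
Qed.

Lemma Rabs_0_lt d : 0 < d -> forall x, Rabs (x - x) < d.
Proof. intros Hd x; rewrite Rminus_diag, Rabs_R0; exact Hd. Qed.

(** Being products of intervals, these balls contain the paths with sides parallel to the axes along
    which the mean value theorem and the integrals below are applied. *)
Definition square (a b d : R) : R -> R -> Prop :=
  fun x y => Rabs (x - a) < d /\ Rabs (y - b) < d.

Lemma square_center a b d : 0 < d -> square a b d a b.
Proof. intros Hd; split; apply Rabs_0_lt, Hd. Qed.

Lemma open2_square a b d : open2 (square a b d).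
Proof.
  intros x y [Hx Hy].
  exists (Rmin (d - Rabs (x - a)) (d - Rabs (y - b))); split.
  - apply Rmin_pos; lra.
  - intros x' y' Hx' Hy'.
    pose proof (Rmin_l (d - Rabs (x - a)) (d - Rabs (y - b))).
    pose proof (Rmin_r (d - Rabs (x - a)) (d - Rabs (y - b))).
    split.
    + replace (x' - a) with ((x' - x) + (x - a)) by ring.
      pose proof (Rabs_triang (x' - x) (x - a)); lra.
    + replace (y' - b) with ((y' - y) + (y - b)) by ring.
      pose proof (Rabs_triang (y' - y) (y - b)); lra.
Qed.

Lemma Rabs_convex a d x y c :
  Rabs (x - a) < d -> Rabs (y - a) < d -> Rmin x y <= c <= Rmax x y ->
  Rabs (c - a) < d.
Proof.
  unfold Rmin, Rmax; destruct (Rle_dec x y);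
  unfold Rabs; repeat destruct Rcase_abs; lra.
Qed.

Lemma open2_inter U V : open2 U -> open2 V -> open2 (fun x y => U x y /\ V x y).
Proof.
  intros HU HV x y [Hu Hv].
  destruct (HU x y Hu) as [d [Hd Ud]]; destruct (HV x y Hv) as [e [He Ve]].
  exists (Rmin d e); split; [apply Rmin_pos; lra|].
  intros x' y' Hx Hy.
  pose proof (Rmin_l d e); pose proof (Rmin_r d e).
  split; [apply Ud | apply Ve]; lra.
Qed.

Lemma open2_square_incl U x y : open2 U -> U x y ->
  exists d, 0 < d /\ subset2 (square x y d) U.
Proof.
  intros HU Hxy; destruct (HU x y Hxy) as [d [Hd Ud]].
  exists d; split; [exact Hd|]. intros x' y' [Hx Hy]; apply Ud; assumption.
Qed.

Lemma square_mono a b d e : d <= e -> subset2 (square a b d) (square a b e).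
Proof. intros Hde x y [Hx Hy]; split; lra. Qed.

Lemma subset2_trans A B C : subset2 A B -> subset2 B C -> subset2 A C.
Proof. intros H K a b Hab; apply K, H, Hab. Qed.

(** * Calculus of explicit partial derivatives *)

Lemma dprim_subset U V g w : subset2 V U -> dprim U g w -> dprim V g w.
Proof. intros HVU Hg x y Hxy; apply Hg, HVU, Hxy. Qed.

Lemma dprim_ext U g h w : open2 U -> (forall x y, U x y -> g x y = h x y) ->
  dprim U g w -> dprim U h w.
Proof.
  intros HU E Hg x y Hxy.
  destruct (HU x y Hxy) as [d [Hd Ud]]; destruct (Hg x y Hxy) as [H1 H2].
  split.
  - apply (derivable_pt_lim_ext_loc (fun t => g t y) _ _ _ d Hd); [|exact H1].
    intros s Hs; apply E, Ud; [exact Hs | apply Rabs_0_lt, Hd].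
  - apply (derivable_pt_lim_ext_loc (fun t => g x t) _ _ _ d Hd); [|exact H2].
    intros s Hs; apply E, Ud; [apply Rabs_0_lt, Hd | exact Hs].
Qed.

Lemma dprim_value U g (w v : form) : dprim U g w ->
  (forall x y, U x y -> fst w x y = fst v x y /\ snd w x y = snd v x y) ->
  dprim U g v.
Proof.
  intros Hg E x y Hxy; destruct (E x y Hxy) as [<- <-]; apply Hg, Hxy.
Qed.

Lemma dprim_pd1 U g w x y : dprim U g w -> U x y -> pd1 g x y = fst w x y.
Proof. intros Hg Hxy; apply der_eq, (Hg x y Hxy). Qed.

Lemma dprim_pd2 U g w x y : dprim U g w -> U x y -> pd2 g x y = snd w x y.
Proof. intros Hg Hxy; apply der_eq, (Hg x y Hxy). Qed.

Lemma has_pd_dprim U g : has_pd_on U g -> dprim U g (pd1 g, pd2 g).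
Proof.
  intros Hg x y Hxy; destruct (Hg x y Hxy) as [H1 H2].
  split; [apply (der_spec (fun t => g t y)), H1 | apply (der_spec (fun t => g x t)), H2].
Qed.

Lemma dprim_has_pd U g w : dprim U g w -> has_pd_on U g.
Proof.
  intros Hg x y Hxy; destruct (Hg x y Hxy) as [H1 H2].
  split; [exists (fst w x y) | exists (snd w x y)]; assumption.
Qed.

(** Openness of U makes g and h agree along a whole interval through the point; derivability then
    passes from g to h. *)
Lemma pd1_ext U g h x y : open2 U -> (forall a b, U a b -> g a b = h a b) ->
  has_pd_on U g -> U x y -> pd1 h x y = pd1 g x y.
Proof.
  intros HU E Hg Hxy.
  exact (dprim_pd1 U h _ x y (dprim_ext U g h _ HU E (has_pd_dprim U g Hg)) Hxy).
Qed.

Lemma pd2_ext U g h x y : open2 U -> (forall a b, U a b -> g a b = h a b) ->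
  has_pd_on U g -> U x y -> pd2 h x y = pd2 g x y.
Proof.
  intros HU E Hg Hxy.
  exact (dprim_pd2 U h _ x y (dprim_ext U g h _ HU E (has_pd_dprim U g Hg)) Hxy).
Qed.

Lemma dprim_const U c : dprim U (fun _ _ => c) (fun _ _ => 0, fun _ _ => 0).
Proof. intros x y _; split; apply derivable_pt_lim_const. Qed.

Lemma dprim_fst U : dprim U (fun x _ => x) (fun _ _ => 1, fun _ _ => 0).
Proof.
  intros x y _; split; [apply derivable_pt_lim_id | apply derivable_pt_lim_const].
Qed.

Lemma dprim_snd U : dprim U (fun _ y => y) (fun _ _ => 0, fun _ _ => 1).
Proof.
  intros x y _; split; [apply derivable_pt_lim_const | apply derivable_pt_lim_id].
Qed.

Lemma dprim_plus U g h w v : dprim U g w -> dprim U h v ->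
  dprim U (fun x y => g x y + h x y)
    (fun x y => fst w x y + fst v x y, fun x y => snd w x y + snd v x y).
Proof.
  intros Hg Hh x y Hxy; destruct (Hg x y Hxy), (Hh x y Hxy).
  split.
  - apply (derivable_pt_lim_plus (fun t => g t y) (fun t => h t y)); assumption.
  - apply (derivable_pt_lim_plus (fun t => g x t) (fun t => h x t)); assumption.
Qed.

Lemma dprim_opp U g w : dprim U g w ->
  dprim U (fun x y => - g x y) (fun x y => - fst w x y, fun x y => - snd w x y).
Proof.
  intros Hg x y Hxy; destruct (Hg x y Hxy).
  split.
  - apply (derivable_pt_lim_opp (fun t => g t y)); assumption.
  - apply (derivable_pt_lim_opp (fun t => g x t)); assumption.
Qed.

Lemma dprim_minus U g h w v : dprim U g w -> dprim U h v ->
  dprim U (fun x y => g x y - h x y)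
    (fun x y => fst w x y - fst v x y, fun x y => snd w x y - snd v x y).
Proof. intros Hg Hh; exact (dprim_plus U g _ w _ Hg (dprim_opp U h v Hh)). Qed.

Lemma dprim_mult U g h w v : dprim U g w -> dprim U h v ->
  dprim U (fun x y => g x y * h x y)
    (fun x y => fst w x y * h x y + g x y * fst v x y,
     fun x y => snd w x y * h x y + g x y * snd v x y).
Proof.
  intros Hg Hh x y Hxy; destruct (Hg x y Hxy), (Hh x y Hxy).
  split.
  - apply (derivable_pt_lim_mult (fun t => g t y) (fun t => h t y)); assumption.
  - apply (derivable_pt_lim_mult (fun t => g x t) (fun t => h x t)); assumption.
Qed.

Lemma dprim_comp1 U phi dphi g w : dprim U g w ->
  (forall x y, U x y -> derivable_pt_lim phi (g x y) (dphi (g x y))) ->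
  dprim U (fun x y => phi (g x y))
    (fun x y => dphi (g x y) * fst w x y, fun x y => dphi (g x y) * snd w x y).
Proof.
  intros Hg Hphi x y Hxy; destruct (Hg x y Hxy).
  split.
  - apply (derivable_pt_lim_comp (fun t => g t y) phi); [assumption | apply Hphi, Hxy].
  - apply (derivable_pt_lim_comp (fun t => g x t) phi); [assumption | apply Hphi, Hxy].
Qed.

(** * Joint continuity, differentiability and the chain rule *)

Lemma cont2_on_continuity_2d U g :
  cont2_on U g <-> forall x y, U x y -> continuity_2d_pt g x y.
Proof.
  split.
  - intros Hg x y Hxy eps.
    destruct (Hg x y Hxy eps (cond_pos eps)) as [d [Hd E]].
    exists (mkposreal d Hd); exact E.
  - intros Hg x y Hxy e He.
    destruct (Hg x y Hxy (mkposreal e He)) as [d E].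
    exists d; split; [apply cond_pos | exact E].
Qed.

Lemma continuity_2d_pt_comp g h k x y :
  continuity_2d_pt g (h x y) (k x y) ->
  continuity_2d_pt h x y -> continuity_2d_pt k x y ->
  continuity_2d_pt (fun u v => g (h u v) (k u v)) x y.
Proof.
  intros Hg Hh Hk eps.
  destruct (Hg eps) as [d E].
  apply (locally_2d_impl _ _ _ _) with (2 := Hh d).
  apply (locally_2d_impl _ _ _ _) with (2 := Hk d).
  exists d; intros u v _ _ Hku Hhu; apply E; assumption.
Qed.

Lemma cont2_on_comp A B g h k : cont2_on B g -> cont2_on A h -> cont2_on A k ->
  (forall x y, A x y -> B (h x y) (k x y)) ->
  cont2_on A (fun x y => g (h x y) (k x y)).
Proof.
  rewrite !cont2_on_continuity_2d; intros Hg Hh Hk HAB x y Hxy.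
  apply continuity_2d_pt_comp; auto.
Qed.

(** The increment is split along the path (x, y), (x, v), (u, v). On each side the mean value
    theorem gives a partial derivative at a nearby point, within eps/2 of its value at (x, y) by
    continuity. *)
Lemma dprim_differentiable U g w x y : open2 U -> dprim U g w -> U x y ->
  continuity_2d_pt (fst w) x y -> continuity_2d_pt (snd w) x y ->
  differentiable_pt_lim g x y (fst w x y) (snd w x y).
Proof.
  intros HU Hg Hxy C1 C2 eps.
  assert (He : 0 < eps / 2) by (pose proof (cond_pos eps); lra).
  destruct (open2_square_incl U x y HU Hxy) as [d [Hd Ud]].
  destruct (C1 (mkposreal _ He)) as [d1 E1]; destruct (C2 (mkposreal _ He)) as [d2 E2].
  simpl in E1, E2.
  assert (Hm : 0 < Rmin d (Rmin d1 d2)) by (repeat apply Rmin_pos; auto; apply cond_pos).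
  exists (mkposreal _ Hm); simpl; intros u v Hu Hv.
  pose proof (Rmin_l d (Rmin d1 d2)); pose proof (Rmin_r d (Rmin d1 d2)).
  pose proof (Rmin_l d1 d2); pose proof (Rmin_r d1 d2).
  destruct (MVT_segment (fun t => g t v) (fun t => fst w t v) x u) as [c [Hc Ec]].
  { intros t Ht; apply (Hg t v), Ud.
    split; [apply (Rabs_between x u) | ]; lra. }
  destruct (MVT_segment (fun t => g x t) (fun t => snd w x t) y v) as [c' [Hc' Ec']].
  { intros t Ht; apply (Hg x t), Ud.
    split; [apply Rabs_0_lt, Hd | apply (Rabs_between y v); lra]. }
  assert (B1 : Rabs (fst w c v - fst w x y) < eps / 2).
  { apply E1; [apply (Rabs_between x u); lra | lra]. }
  assert (B2 : Rabs (snd w x c' - snd w x y) < eps / 2).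
  { apply E2; [apply Rabs_0_lt, cond_pos | apply (Rabs_between y v); lra]. }
  replace (g u v - g x y - (fst w x y * (u - x) + snd w x y * (v - y)))
    with ((fst w c v - fst w x y) * (u - x) + (snd w x c' - snd w x y) * (v - y)) by lra.
  pose proof (Rmax_l (Rabs (u - x)) (Rabs (v - y))).
  pose proof (Rmax_r (Rabs (u - x)) (Rabs (v - y))).
  set (M := Rmax (Rabs (u - x)) (Rabs (v - y))) in *.
  eapply Rle_trans; [apply Rabs_triang|]; rewrite !Rabs_mult.
  pose proof (Rabs_pos (u - x)); pose proof (Rabs_pos (v - y)).
  assert (Rabs (fst w c v - fst w x y) * Rabs (u - x) <= eps / 2 * M)
    by (apply Rmult_le_compat; try apply Rabs_pos; lra).
  assert (Rabs (snd w x c' - snd w x y) * Rabs (v - y) <= eps / 2 * M)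
    by (apply Rmult_le_compat; try apply Rabs_pos; lra).
  lra.
Qed.

Lemma dprim_cont2 U g w : open2 U -> dprim U g w ->
  cont2_on U (fst w) -> cont2_on U (snd w) -> cont2_on U g.
Proof.
  rewrite !cont2_on_continuity_2d; intros HU Hg C1 C2 x y Hxy.
  apply differentiable_continuity_pt; exists (fst w x y), (snd w x y).
  apply (dprim_differentiable U g w); auto.
Qed.

Lemma derivable_pt_lim_comp2 B g w h k t lh lk :
  open2 B -> dprim B g w -> cont2_on B (fst w) -> cont2_on B (snd w) ->
  B (h t) (k t) -> derivable_pt_lim h t lh -> derivable_pt_lim k t lk ->
  derivable_pt_lim (fun s => g (h s) (k s)) t
    (fst w (h t) (k t) * lh + snd w (h t) (k t) * lk).
Proof.
  rewrite !cont2_on_continuity_2d; intros HB Hg C1 C2 Ht Hh Hk.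
  apply derivable_pt_lim_comp_2d; [|assumption|assumption].
  apply (dprim_differentiable B); auto.
Qed.

Lemma dprim_comp2 A B g h k w v z :
  open2 B -> dprim B g w -> cont2_on B (fst w) -> cont2_on B (snd w) ->
  dprim A h v -> dprim A k z -> (forall x y, A x y -> B (h x y) (k x y)) ->
  dprim A (fun x y => g (h x y) (k x y))
    (fun x y => fst w (h x y) (k x y) * fst v x y + snd w (h x y) (k x y) * fst z x y,
     fun x y => fst w (h x y) (k x y) * snd v x y + snd w (h x y) (k x y) * snd z x y).
Proof.
  intros HB Hg C1 C2 Hh Hk HAB x y Hxy; destruct (Hh x y Hxy), (Hk x y Hxy).
  split.
  - apply (derivable_pt_lim_comp2 B g w (fun t => h t y) (fun t => k t y)); auto.
  - apply (derivable_pt_lim_comp2 B g w (fun t => h x t) (fun t => k x t)); auto.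
Qed.

(** Two sides parallel to the axes join the centre to any point of the square. This is the source of
    the uniqueness of H up to translation. *)
Lemma dprim_zero_square a b d g :
  dprim (square a b d) g (fun _ _ => 0, fun _ _ => 0) ->
  forall x y, square a b d x y -> g x y = g a b.
Proof.
  intros Hg x y [Hx Hy].
  assert (Hd : 0 < d) by (pose proof (Rabs_pos (x - a)); lra).
  destruct (MVT_segment (fun t => g t y) (fun _ => 0) a x) as [c [_ Ec]].
  { intros t Ht; apply (Hg t y); split; [apply (Rabs_between a x)|]; lra. }
  destruct (MVT_segment (fun t => g a t) (fun _ => 0) b y) as [c' [_ Ec']].
  { intros t Ht; apply (Hg a t); split;
      [apply Rabs_0_lt, Hd | apply (Rabs_between b y); lra]. }
  lra.
Qed.

(** * Functions of class C^k *)

Lemma Ck2_cont U k g : Ck2 U k g -> cont2_on U g.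
Proof. destruct k; [intros H; exact H | intros [H _]; exact H]. Qed.

Lemma Ck2_elim U k g : Ck2 U (S k) g ->
  dprim U g (pd1 g, pd2 g) /\ Ck2 U k (pd1 g) /\ Ck2 U k (pd2 g).
Proof.
  intros [_ [Hp [H1 H2]]]; split; [apply has_pd_dprim, Hp | split; assumption].
Qed.

Lemma cont2_on_ext U g h : open2 U -> (forall x y, U x y -> g x y = h x y) ->
  cont2_on U g -> cont2_on U h.
Proof.
  rewrite !cont2_on_continuity_2d; intros HU E Hg x y Hxy.
  apply (continuity_2d_pt_ext_loc g); [|apply Hg, Hxy].
  destruct (HU x y Hxy) as [d [Hd Ud]].
  exists (mkposreal d Hd); intros u v Hu Hv; apply E, Ud; assumption.
Qed.

Lemma Ck2_ext U k g h : open2 U -> (forall x y, U x y -> g x y = h x y) ->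
  Ck2 U k g -> Ck2 U k h.
Proof.
  intros HU; revert g h; induction k as [|k IH]; intros g h E Hg.
  - apply (cont2_on_ext U g); assumption.
  - destruct Hg as [Hc [Hp [H1 H2]]].
    pose proof (dprim_ext U g h _ HU E (has_pd_dprim U g Hp)) as Hh.
    split; [|split; [|split]].
    + apply (cont2_on_ext U g); assumption.
    + apply (dprim_has_pd U h _ Hh).
    + apply (IH (pd1 g)); [|exact H1].
      intros x y Hxy; symmetry; apply (dprim_pd1 U h _ x y Hh Hxy).
    + apply (IH (pd2 g)); [|exact H2].
      intros x y Hxy; symmetry; apply (dprim_pd2 U h _ x y Hh Hxy).
Qed.

(** [Ck2] is defined through the chosen derivatives [pd1], [pd2]; here any explicit partial
    derivatives will do, which is what the inductions on k below can supply. *)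
Lemma Ck2_intro U k g w : open2 U -> dprim U g w ->
  Ck2 U k (fst w) -> Ck2 U k (snd w) -> Ck2 U (S k) g.
Proof.
  intros HU Hg H1 H2; split; [|split; [|split]].
  - apply (dprim_cont2 U g w HU Hg); apply (Ck2_cont U k); assumption.
  - apply (dprim_has_pd U g w Hg).
  - apply (Ck2_ext U k (fst w)); auto.
    intros x y Hxy; symmetry; apply (dprim_pd1 U g w x y Hg Hxy).
  - apply (Ck2_ext U k (snd w)); auto.
    intros x y Hxy; symmetry; apply (dprim_pd2 U g w x y Hg Hxy).
Qed.

Lemma Ck2_pred U k g : Ck2 U (S k) g -> Ck2 U k g.
Proof.
  revert g; induction k as [|k IH]; intros g [Hc [Hp [H1 H2]]]; [exact Hc|].
  split; [|split; [|split]]; auto.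
Qed.

Lemma Ck2_subset U V k g : subset2 V U -> Ck2 U k g -> Ck2 V k g.
Proof.
  intros HVU; revert g; induction k as [|k IH]; intros g.
  - intros Hg x y Hxy; apply Hg, HVU, Hxy.
  - intros [Hc [Hp [H1 H2]]]; split; [|split; [|split]].
    + intros x y Hxy; apply Hc, HVU, Hxy.
    + intros x y Hxy; apply Hp, HVU, Hxy.
    + apply IH, H1.
    + apply IH, H2.
Qed.

(** Each clause of [Ck2] is a condition at one point on g and on the globally defined [pd1 g],
    [pd2 g], so each point may come with its own V. This serves [p_smooth2], where f is inverted
    only locally. *)
Lemma Ck2_local U k g :
  (forall x y, U x y -> exists V : R -> R -> Prop, V x y /\ Ck2 V k g) -> Ck2 U k g.
Proof.
  revert g; induction k as [|k IH]; intros g Hg.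
  - intros x y Hxy; destruct (Hg x y Hxy) as [V [Vxy H]]; apply H, Vxy.
  - split; [|split; [|split]].
    + intros x y Hxy; destruct (Hg x y Hxy) as [V [Vxy [H _]]]; apply H, Vxy.
    + intros x y Hxy; destruct (Hg x y Hxy) as [V [Vxy [_ [H _]]]]; apply H, Vxy.
    + apply IH; intros x y Hxy; destruct (Hg x y Hxy) as [V [Vxy [_ [_ [H _]]]]].
      exists V; split; assumption.
    + apply IH; intros x y Hxy; destruct (Hg x y Hxy) as [V [Vxy [_ [_ [_ H]]]]].
      exists V; split; assumption.
Qed.

Lemma Ck2_const U k c : open2 U -> Ck2 U k (fun _ _ => c).
Proof.
  intros HU; revert c; induction k as [|k IH]; intros c.
  - apply cont2_on_continuity_2d; intros x y _; apply continuity_2d_pt_const.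
  - apply (Ck2_intro U k _ _ HU (dprim_const U c)); cbn [fst snd]; apply IH.
Qed.

Lemma Ck2_fst U k : open2 U -> Ck2 U k (fun x _ => x).
Proof.
  intros HU; destruct k as [|k].
  - apply cont2_on_continuity_2d; intros x y _; apply continuity_2d_pt_id1.
  - apply (Ck2_intro U k _ _ HU (dprim_fst U)); cbn [fst snd]; apply Ck2_const, HU.
Qed.

Lemma Ck2_snd U k : open2 U -> Ck2 U k (fun _ y => y).
Proof.
  intros HU; destruct k as [|k].
  - apply cont2_on_continuity_2d; intros x y _; apply continuity_2d_pt_id2.
  - apply (Ck2_intro U k _ _ HU (dprim_snd U)); cbn [fst snd]; apply Ck2_const, HU.
Qed.

Lemma Ck2_plus U k g h : open2 U -> Ck2 U k g -> Ck2 U k h ->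
  Ck2 U k (fun x y => g x y + h x y).
Proof.
  intros HU; revert g h; induction k as [|k IH]; intros g h Hg Hh.
  - simpl in *; rewrite !cont2_on_continuity_2d in *; intros x y Hxy.
    apply continuity_2d_pt_plus; auto.
  - destruct (Ck2_elim U k g Hg) as [Dg [G1 G2]].
    destruct (Ck2_elim U k h Hh) as [Dh [H1 H2]].
    apply (Ck2_intro U k _ _ HU (dprim_plus U g h _ _ Dg Dh)); cbn [fst snd]; apply IH; assumption.
Qed.

Lemma Ck2_mult U k g h : open2 U -> Ck2 U k g -> Ck2 U k h ->
  Ck2 U k (fun x y => g x y * h x y).
Proof.
  intros HU; revert g h; induction k as [|k IH]; intros g h Hg Hh.
  - simpl in *; rewrite !cont2_on_continuity_2d in *; intros x y Hxy.
    apply continuity_2d_pt_mult; auto.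
  - destruct (Ck2_elim U k g Hg) as [Dg [G1 G2]].
    destruct (Ck2_elim U k h Hh) as [Dh [H1 H2]].
    apply (Ck2_intro U k _ _ HU (dprim_mult U g h _ _ Dg Dh)); cbn [fst snd];
      (apply Ck2_plus; [exact HU | | ]; apply IH; auto using Ck2_pred).
Qed.

(** The derivatives of phi(g) are phi'(g) times those of g, so the induction replaces phi by phi'
    and keeps g fixed. [Ck2_comp2] follows the same pattern. *)
Lemma Ck2_comp1 A U k phi g : open2 U -> Ck1 A k phi -> Ck2 U k g ->
  (forall x y, U x y -> A (g x y)) -> Ck2 U k (fun x y => phi (g x y)).
Proof.
  intros HU; revert phi; induction k as [|k IH]; intros phi Hphi Hg HA.
  - simpl in *; rewrite !cont2_on_continuity_2d in *; intros x y Hxy.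
    apply continuity_1d_2d_pt_comp; auto.
  - destruct Hphi as [_ [Hd Hk]].
    destruct (Ck2_elim U k g Hg) as [Dg [G1 G2]].
    assert (Hc : dprim U (fun x y => phi (g x y))
      (fun x y => der phi (g x y) * pd1 g x y, fun x y => der phi (g x y) * pd2 g x y)).
    { apply (dprim_comp1 U phi (der phi) g _ Dg).
      intros x y Hxy; apply der_spec, Hd, HA, Hxy. }
    apply (Ck2_intro U k _ _ HU Hc); simpl;
      (apply Ck2_mult; [exact HU | apply IH; auto using Ck2_pred | assumption]).
Qed.

Lemma Ck2_comp2 A B k g h l : open2 A -> open2 B -> Ck2 B k g ->
  Ck2 A k h -> Ck2 A k l -> (forall x y, A x y -> B (h x y) (l x y)) ->
  Ck2 A k (fun x y => g (h x y) (l x y)).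
Proof.
  intros HA HB; revert g; induction k as [|k IH]; intros g Hg Hh Hl HAB.
  - exact (cont2_on_comp A B g h l Hg Hh Hl HAB).
  - destruct (Ck2_elim B k g Hg) as [Dg [G1 G2]].
    destruct (Ck2_elim A k h Hh) as [Dh [H1 H2]].
    destruct (Ck2_elim A k l Hl) as [Dl [L1 L2]].
    assert (Hc := dprim_comp2 A B g h l _ _ _ HB Dg (Ck2_cont B k _ G1) (Ck2_cont B k _ G2)
                    Dh Dl HAB).
    apply (Ck2_intro A k _ _ HA Hc); simpl;
      (apply Ck2_plus; [exact HA | | ]; apply Ck2_mult; auto using Ck2_pred).
Qed.

(** * Smooth functions *)

Lemma smooth2_ext U g h : open2 U -> (forall x y, U x y -> g x y = h x y) ->
  smooth2 U g -> smooth2 U h.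
Proof. intros HU E Hg k; apply (Ck2_ext U k g); auto. Qed.

Lemma smooth2_subset U V g : subset2 V U -> smooth2 U g -> smooth2 V g.
Proof. intros HVU Hg k; apply (Ck2_subset U V k g HVU), Hg. Qed.

Lemma smooth2_dprim U g : smooth2 U g -> dprim U g (pd1 g, pd2 g).
Proof. intros Hg; apply (Ck2_elim U 0), Hg. Qed.

Lemma smooth2_cont U g : smooth2 U g -> cont2_on U g.
Proof. intros Hg; apply (Hg 0%nat). Qed.

Lemma smooth2_pd1 U g : smooth2 U g -> smooth2 U (pd1 g).
Proof. intros Hg k; apply (Ck2_elim U k), Hg. Qed.

Lemma smooth2_pd2 U g : smooth2 U g -> smooth2 U (pd2 g).
Proof. intros Hg k; apply (Ck2_elim U k), Hg. Qed.

Lemma smooth2_has_pd U g : smooth2 U g -> has_pd_on U g.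
Proof. intros Hg; apply (dprim_has_pd U g _ (smooth2_dprim U g Hg)). Qed.

Lemma dprim_smooth2 U g w : open2 U -> dprim U g w ->
  smooth2 U (fst w) -> smooth2 U (snd w) -> smooth2 U g.
Proof.
  intros HU Hg H1 H2 k; apply Ck2_pred, (Ck2_intro U k g w HU Hg); [apply H1 | apply H2].
Qed.

Lemma smooth2_const U c : open2 U -> smooth2 U (fun _ _ => c).
Proof. intros HU k; apply Ck2_const, HU. Qed.

Lemma smooth2_plus U g h : open2 U -> smooth2 U g -> smooth2 U h ->
  smooth2 U (fun x y => g x y + h x y).
Proof. intros HU Hg Hh k; apply Ck2_plus; auto. Qed.

Lemma smooth2_mult U g h : open2 U -> smooth2 U g -> smooth2 U h ->
  smooth2 U (fun x y => g x y * h x y).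
Proof. intros HU Hg Hh k; apply Ck2_mult; auto. Qed.

Lemma smooth2_opp U g : open2 U -> smooth2 U g -> smooth2 U (fun x y => - g x y).
Proof.
  intros HU Hg; apply (smooth2_ext U (fun x y => (-1) * g x y)); [exact HU | | ].
  - intros x y _; ring.
  - apply smooth2_mult; auto using smooth2_const.
Qed.

Lemma smooth2_minus U g h : open2 U -> smooth2 U g -> smooth2 U h ->
  smooth2 U (fun x y => g x y - h x y).
Proof.
  intros HU Hg Hh; exact (smooth2_plus U g _ HU Hg (smooth2_opp U h HU Hh)).
Qed.

Lemma smooth2_comp1 A U phi g : open2 U -> smooth1 A phi -> smooth2 U g ->
  (forall x y, U x y -> A (g x y)) -> smooth2 U (fun x y => phi (g x y)).
Proof. intros HU Hphi Hg HA k; apply (Ck2_comp1 A); auto. Qed.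

Lemma smooth2_comp2 A B g h l : open2 A -> open2 B -> smooth2 B g ->
  smooth2 A h -> smooth2 A l -> (forall x y, A x y -> B (h x y) (l x y)) ->
  smooth2 A (fun x y => g (h x y) (l x y)).
Proof. intros HA HB Hg Hh Hl HAB k; apply (Ck2_comp2 A B); auto. Qed.

Lemma smooth2_comp2_dprim A B g h l : open2 A -> open2 B -> smooth2 B g ->
  smooth2 A h -> smooth2 A l -> (forall x y, A x y -> B (h x y) (l x y)) ->
  dprim A (fun x y => g (h x y) (l x y))
    (fun x y => pd1 g (h x y) (l x y) * pd1 h x y + pd2 g (h x y) (l x y) * pd1 l x y,
     fun x y => pd1 g (h x y) (l x y) * pd2 h x y + pd2 g (h x y) (l x y) * pd2 l x y).
Proof.
  intros HA HB Hg Hh Hl HAB.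
  apply (dprim_comp2 A B g h l (pd1 g, pd2 g) (pd1 h, pd2 h) (pd1 l, pd2 l));
    cbn [fst snd]; auto using smooth2_dprim, smooth2_cont, smooth2_pd1, smooth2_pd2.
Qed.

(** [Schwarz] speaks of iterated [Derive], which is identified with [pd1] and [pd2] only on U; the
    auxiliary equations make this identification for first and then for mixed derivatives. *)
Lemma smooth2_Schwarz U g x y : open2 U -> smooth2 U g -> U x y ->
  pd1 (pd2 g) x y = pd2 (pd1 g) x y.
Proof.
  intros HU Hg Hxy.
  assert (D := smooth2_dprim U g Hg).
  assert (D1 := smooth2_dprim U _ (smooth2_pd1 U g Hg)).
  assert (D2 := smooth2_dprim U _ (smooth2_pd2 U g Hg)).
  assert (E1 : forall u v, U u v -> Derive (fun t => g t v) u = pd1 g u v).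
  { intros u v Huv; apply is_derive_unique, is_derive_Reals, (D u v Huv). }
  assert (E2 : forall u v, U u v -> Derive (fun t => g u t) v = pd2 g u v).
  { intros u v Huv; apply is_derive_unique, is_derive_Reals, (D u v Huv). }
  assert (F1 := dprim_ext U (pd1 g) (fun u v => Derive (fun t => g t v) u) _ HU
                 (fun u v H => eq_sym (E1 u v H)) D1).
  assert (F2 := dprim_ext U (pd2 g) (fun u v => Derive (fun t => g u t) v) _ HU
                 (fun u v H => eq_sym (E2 u v H)) D2).
  assert (G21 : forall u v, U u v ->
    Derive (fun z => Derive (fun t => g z t) v) u = pd1 (pd2 g) u v).
  { intros u v Huv; apply is_derive_unique, is_derive_Reals, (F2 u v Huv). }
  assert (G12 : forall u v, U u v ->
    Derive (fun z => Derive (fun t => g t z) u) v = pd2 (pd1 g) u v).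
  { intros u v Huv; apply is_derive_unique, is_derive_Reals, (F1 u v Huv). }
  rewrite <- G21, <- G12 by exact Hxy.
  destruct (HU x y Hxy) as [d [Hd Ud]].
  apply Schwarz.
  - exists (mkposreal d Hd); intros u v Hu Hv.
    specialize (Ud u v Hu Hv).
    destruct (D u v Ud) as [A1 A2], (F1 u v Ud) as [_ A3], (F2 u v Ud) as [A4 _].
    split; [|split; [|split]]; eexists; apply is_derive_Reals; eassumption.
  - apply (continuity_2d_pt_ext_loc (pd1 (pd2 g))).
    + exists (mkposreal d Hd); intros u v Hu Hv; symmetry; apply G21, Ud; assumption.
    + apply (cont2_on_continuity_2d U); [|exact Hxy].
      apply smooth2_cont, smooth2_pd1, smooth2_pd2, Hg.
  - apply (continuity_2d_pt_ext_loc (pd2 (pd1 g))).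
    + exists (mkposreal d Hd); intros u v Hu Hv; symmetry; apply G12, Ud; assumption.
    + apply (cont2_on_continuity_2d U); [|exact Hxy].
      apply smooth2_cont, smooth2_pd2, smooth2_pd1, Hg.
Qed.

(** The derivatives of 1/g are - (1/g)^2 times those of g: they contain 1/g itself, so class C^k of
    1/g yields class C^(k+1). The square root bootstraps in the same way from its derivative / (2
    sqrt g). *)
Lemma Ck2_inv U k g : open2 U -> Ck2 U k g -> (forall x y, U x y -> g x y <> 0) ->
  Ck2 U k (fun x y => / g x y).
Proof.
  intros HU; induction k as [|k IH]; intros Hg Hn.
  - simpl in *; rewrite !cont2_on_continuity_2d in *; intros x y Hxy.
    apply continuity_2d_pt_inv; auto.
  - destruct (Ck2_elim U k g Hg) as [Dg [G1 G2]].
    specialize (IH (Ck2_pred U k g Hg) Hn).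
    assert (Hc : dprim U (fun x y => / g x y)
      (fun x y => (-1) * (/ g x y * / g x y) * pd1 g x y,
       fun x y => (-1) * (/ g x y * / g x y) * pd2 g x y)).
    { apply (dprim_comp1 U Rinv (fun t => (-1) * (/ t * / t)) g _ Dg).
      intros x y Hxy; apply is_derive_Reals.
      auto_derive; [apply Hn, Hxy | field; apply Hn, Hxy]. }
    apply (Ck2_intro U k _ _ HU Hc); cbn [fst snd];
      repeat apply Ck2_mult; auto using Ck2_const.
Qed.

Lemma Ck2_sqrt U k g : open2 U -> Ck2 U k g -> (forall x y, U x y -> 0 < g x y) ->
  Ck2 U k (fun x y => sqrt (g x y)).
Proof.
  intros HU; induction k as [|k IH]; intros Hg Hn.
  - simpl in *; rewrite !cont2_on_continuity_2d in *; intros x y Hxy.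
    apply continuity_1d_2d_pt_comp; auto.
    apply continuity_pt_sqrt, Rlt_le, Hn, Hxy.
  - destruct (Ck2_elim U k g Hg) as [Dg [G1 G2]].
    specialize (IH (Ck2_pred U k g Hg) Hn).
    assert (Hc : dprim U (fun x y => sqrt (g x y))
      (fun x y => / (2 * sqrt (g x y)) * pd1 g x y,
       fun x y => / (2 * sqrt (g x y)) * pd2 g x y)).
    { apply (dprim_comp1 U sqrt (fun t => / (2 * sqrt t)) g _ Dg).
      intros x y Hxy; apply derivable_pt_lim_sqrt, Hn, Hxy. }
    apply (Ck2_intro U k _ _ HU Hc); cbn [fst snd];
      (apply Ck2_mult; [exact HU | | assumption]; apply Ck2_inv;
       [exact HU | apply Ck2_mult; auto using Ck2_const |]);
      intros x y Hxy; pose proof (sqrt_lt_R0 _ (Hn x y Hxy)); lra.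
Qed.

Lemma smooth2_inv U g : open2 U -> smooth2 U g -> (forall x y, U x y -> g x y <> 0) ->
  smooth2 U (fun x y => / g x y).
Proof. intros HU Hg Hn k; apply Ck2_inv; auto. Qed.

Lemma smooth2_div U g h : open2 U -> smooth2 U g -> smooth2 U h ->
  (forall x y, U x y -> h x y <> 0) -> smooth2 U (fun x y => g x y / h x y).
Proof.
  intros HU Hg Hh Hn; apply (smooth2_mult U g); auto using smooth2_inv.
Qed.

Lemma smooth2_sqrt U g : open2 U -> smooth2 U g -> (forall x y, U x y -> 0 < g x y) ->
  smooth2 U (fun x y => sqrt (g x y)).
Proof. intros HU Hg Hn k; apply Ck2_sqrt; auto. Qed.

Lemma smooth2_Jac U g h : open2 U -> smooth2 U g -> smooth2 U h -> smooth2 U (Jac g h).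
Proof.
  intros HU Hg Hh; apply smooth2_minus; auto; apply smooth2_mult;
    auto using smooth2_pd1, smooth2_pd2.
Qed.

Lemma smooth2_Jdet U g : open2 U -> smooth2 U g -> smooth2 U (Jdet g).
Proof.
  intros HU Hg; apply smooth2_minus; auto; apply smooth2_mult;
    auto using smooth2_pd1, smooth2_pd2.
Qed.

Lemma smooth1_der A g : smooth1 A g -> smooth1 A (der g).
Proof. intros Hg k; apply (Hg (S k)). Qed.

Lemma smooth1_derivable A g t : smooth1 A g -> A t -> derivable_pt_lim g t (der g t).
Proof. intros Hg Ht; apply der_spec; apply (Hg 1%nat); exact Ht. Qed.

Lemma cont2_pos_square U g x y : open2 U -> cont2_on U g -> U x y -> 0 < g x y ->
  exists d, 0 < d /\ subset2 (square x y d) U /\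
    forall u v, square x y d u v -> 0 < g u v.
Proof.
  intros HU Hg Hxy Hpos.
  destruct (open2_square_incl U x y HU Hxy) as [d [Hd Ud]].
  destruct (Hg x y Hxy (g x y) Hpos) as [e [He Ge]].
  exists (Rmin d e); split; [apply Rmin_pos; lra | split].
  - apply (subset2_trans _ _ _ (square_mono x y _ d (Rmin_l d e)) Ud).
  - intros u v [Hu Hv]; pose proof (Rmin_r d e).
    assert (B : Rabs (g u v - g x y) < g x y) by (apply Ge; lra).
    apply Rabs_def2 in B; lra.
Qed.

(** * The Poincaré lemma on a square *)

Lemma continuity_2d_pt_slice1 g x y :
  continuity_2d_pt g x y -> continuous (fun t => g t y) x.
Proof.
  intros Hg; apply continuity_pt_filterlim; intros e He.
  destruct (Hg (mkposreal e He)) as [d Hd]; exists d; split; [apply cond_pos|].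
  intros t [_ Ht]; apply Hd; [exact Ht | apply Rabs_0_lt, cond_pos].
Qed.

Lemma continuity_2d_pt_slice2 g x y :
  continuity_2d_pt g x y -> continuous (fun t => g x t) y.
Proof.
  intros Hg; apply continuity_pt_filterlim; intros e He.
  destruct (Hg (mkposreal e He)) as [d Hd]; exists d; split; [apply cond_pos|].
  intros t [_ Ht]; apply Hd; [apply Rabs_0_lt, cond_pos | exact Ht].
Qed.

Lemma ex_RInt_near (h : R -> R) c d y :
  (forall t, Rabs (t - c) < d -> continuous h t) -> Rabs (y - c) < d -> ex_RInt h c y.
Proof.
  intros Hh Hy; apply (@ex_RInt_continuous R_CompleteNormedModule).
  intros t Ht; apply Hh, (Rabs_between c y); assumption.
Qed.

Lemma derivable_pt_lim_RInt (h : R -> R) c d y :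
  (forall t, Rabs (t - c) < d -> continuous h t) -> Rabs (y - c) < d ->
  derivable_pt_lim (fun z => RInt h c z) y (h y).
Proof.
  intros Hh Hy; apply is_derive_Reals.
  apply (is_derive_RInt h (fun z => RInt h c z) c y); [|apply Hh, Hy].
  assert (He : 0 < d - Rabs (y - c)) by lra.
  exists (mkposreal _ He); intros z Hz.
  apply (@RInt_correct R_CompleteNormedModule), (ex_RInt_near h c d); [exact Hh|].
  assert (B : Rabs (z - y) < d - Rabs (y - c)) by exact Hz.
  replace (z - c) with ((z - y) + (y - c)) by ring.
  pose proof (Rabs_triang (z - y) (y - c)); lra.
Qed.

(** The potential is the integral of w = P dx + Q dy along the path (a, b), (x, b), (x, y). Its
    y-derivative is Q by the fundamental theorem. Its x-derivative is P(x, b) plus the integral of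
    Q_x = P_y over the vertical side, that is, P(x, b) + (P(x, y) - P(x, b)). *)
Lemma poincare_square a b d (w : form) : 0 < d ->
  smooth2 (square a b d) (fst w) -> smooth2 (square a b d) (snd w) ->
  (forall x y, square a b d x y -> pd2 (fst w) x y = pd1 (snd w) x y) ->
  exists g, dprim (square a b d) g w.
Proof.
  intros Hd HP HQ Hclosed; set (P := fst w) in *; set (Q := snd w) in *.
  assert (C : forall g, smooth2 (square a b d) g ->
    forall x y, square a b d x y -> continuity_2d_pt g x y).
  { intros g Hg; apply cont2_on_continuity_2d, smooth2_cont, Hg. }
  assert (DP := smooth2_dprim _ _ HP); assert (DQ := smooth2_dprim _ _ HQ).
  exists (fun x y => RInt (fun t => P t b) a x + RInt (fun s => Q x s) b y).
  intros x y [Hx Hy].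
  assert (Hab := Rabs_0_lt d Hd).
  assert (Hseg : forall t, Rmin b y <= t <= Rmax b y -> Rabs (t - b) < d).
  { intros t Ht; apply (Rabs_between b y); assumption. }
  split.
  - apply (derivable_pt_lim_value _ _ (P x b + (P x y - P x b))); [|unfold P; ring].
    apply (derivable_pt_lim_plus (fun t => RInt (fun s => P s b) a t)
             (fun t => RInt (fun s => Q t s) b y)).
    + apply (derivable_pt_lim_RInt (fun s => P s b) a d); [|exact Hx].
      intros t Ht; apply (continuity_2d_pt_slice1 P t b), C; [exact HP | split; auto].
    + assert (ED : forall u v, square a b d u v ->
        Derive (fun z => Q z v) u = pd1 Q u v).
      { intros u v Huv; apply is_derive_unique, is_derive_Reals, (DQ u v Huv). }
      assert (Hloc : locally x (fun u => Rabs (u - a) < d)).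
      { assert (He : 0 < d - Rabs (x - a)) by lra.
        exists (mkposreal _ He); intros u Hu.
        assert (B : Rabs (u - x) < d - Rabs (x - a)) by exact Hu.
        replace (u - a) with ((u - x) + (x - a)) by ring.
        pose proof (Rabs_triang (u - x) (x - a)); lra. }
      apply is_derive_Reals.
      replace (P x y - P x b) with (RInt (fun t => Derive (fun u => Q u t) x) b y).
      * apply (is_derive_RInt_param Q b y x).
        -- revert Hloc; apply filter_imp; intros u Hu t Ht.
           exists (pd1 Q u t); apply is_derive_Reals, (DQ u t).
           split; [exact Hu | apply Hseg, Ht].
        -- intros t Ht; apply (continuity_2d_pt_ext_loc (pd1 Q)).
           ++ destruct (open2_square a b d x t) as [e [He Ue]];
                [split; [exact Hx | apply Hseg, Ht]|].
              exists (mkposreal e He); intros u v Hu Hv; symmetry.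
              apply ED, Ue; assumption.
           ++ apply C; [apply smooth2_pd1, HQ | split; [exact Hx | apply Hseg, Ht]].
        -- revert Hloc; apply filter_imp; intros u Hu.
           apply (ex_RInt_near _ b d); [|exact Hy].
           intros t Ht; apply (continuity_2d_pt_slice2 Q u t), C; [exact HQ | split; auto].
      * rewrite (RInt_ext _ (fun t => pd2 P x t)).
        -- apply is_RInt_unique.
           apply (is_RInt_derive (fun t => P x t) (fun t => pd2 P x t)).
           ++ intros t Ht; apply is_derive_Reals, (DP x t).
              split; [exact Hx | apply Hseg, Ht].
           ++ intros t Ht; apply (continuity_2d_pt_slice2 (pd2 P) x t), C;
                [apply smooth2_pd2, HP | split; [exact Hx | apply Hseg, Ht]].
        -- intros t Ht.
           assert (Ht' : square a b d x t) by (split; [exact Hx | apply Hseg; lra]).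
           rewrite ED, Hclosed by exact Ht'; reflexivity.
  - apply (derivable_pt_lim_value _ _ (0 + Q x y)); [|unfold Q; ring].
    apply (derivable_pt_lim_plus (fun _ => RInt (fun t => P t b) a x)
             (fun t => RInt (fun s => Q x s) b t)).
    + apply derivable_pt_lim_const.
    + apply (derivable_pt_lim_RInt (fun s => Q x s) b d); [|exact Hy].
      intros t Ht; apply (continuity_2d_pt_slice2 Q x t), C; [exact HQ | split; auto].
Qed.

(** * The inverse function theorem in the plane *)

(** The solution is the fixed point of z |-> w - K(z), a contraction of ratio 1/2 for the l^1
    distance. The first step from (x0, y0) has length at most rho / 2, so the iterates never leave
    the ball of radius rho. *)
Lemma contraction_solution (K1 K2 : R -> R -> R) x0 y0 w1 w2 rho :
  (forall x y x' y',
     Rabs (x - x0) + Rabs (y - y0) <= rho -> Rabs (x' - x0) + Rabs (y' - y0) <= rho ->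
     Rabs (K1 x' y' - K1 x y) + Rabs (K2 x' y' - K2 x y)
       <= / 2 * (Rabs (x' - x) + Rabs (y' - y))) ->
  Rabs (w1 - K1 x0 y0 - x0) + Rabs (w2 - K2 x0 y0 - y0) <= rho / 2 ->
  exists x y, Rabs (x - x0) + Rabs (y - y0) <= rho /\
    x + K1 x y = w1 /\ y + K2 x y = w2.
Proof.
  intros Lip Hw.
  assert (Hrho : 0 <= rho).
  { pose proof (Rabs_pos (w1 - K1 x0 y0 - x0)).
    pose proof (Rabs_pos (w2 - K2 x0 y0 - y0)); lra. }
  set (T := fun z : R * R => (w1 - K1 (fst z) (snd z), w2 - K2 (fst z) (snd z))).
  set (z := fun n => Nat.iter n T (x0, y0)).
  set (X := fun n => fst (z n)); set (Y := fun n => snd (z n)).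
  assert (XS : forall n, X (S n) = w1 - K1 (X n) (Y n)) by reflexivity.
  assert (YS : forall n, Y (S n) = w2 - K2 (X n) (Y n)) by reflexivity.
  assert (Hpow : forall n, (/ 2) ^ S n = / 2 * (/ 2) ^ n) by reflexivity.
  assert (Hpos : forall n, 0 < (/ 2) ^ n) by (intros n; apply pow_lt; lra).
  (* The two bounds need each other: the Lipschitz hypothesis is available only inside the ball, and
     staying inside relies on the halving of the steps. *)
  assert (Inv : forall n,
    Rabs (X n - x0) + Rabs (Y n - y0) <= rho * (1 - (/ 2) ^ n) /\
    Rabs (X (S n) - X n) + Rabs (Y (S n) - Y n) <= rho / 2 * (/ 2) ^ n).
  { induction n as [|n [IH1 IH2]].
    - split.
      + unfold X, Y; simpl; rewrite !Rminus_diag, Rabs_R0; lra.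
      + rewrite XS, YS; unfold X, Y; simpl; lra.
    - assert (A : Rabs (X (S n) - x0) + Rabs (Y (S n) - y0) <= rho * (1 - (/ 2) ^ S n)).
      { replace (X (S n) - x0) with ((X (S n) - X n) + (X n - x0)) by ring.
        replace (Y (S n) - y0) with ((Y (S n) - Y n) + (Y n - y0)) by ring.
        pose proof (Rabs_triang (X (S n) - X n) (X n - x0)).
        pose proof (Rabs_triang (Y (S n) - Y n) (Y n - y0)).
        rewrite Hpow; lra. }
      split; [exact A|].
      assert (L : Rabs (K1 (X (S n)) (Y (S n)) - K1 (X n) (Y n))
                  + Rabs (K2 (X (S n)) (Y (S n)) - K2 (X n) (Y n))
                  <= / 2 * (Rabs (X (S n) - X n) + Rabs (Y (S n) - Y n))).
      { pose proof (Hpos n); pose proof (Hpos (S n)); apply Lip; nra. }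
      pose proof (XS n); pose proof (XS (S n)); pose proof (YS n); pose proof (YS (S n)).
      replace (X (S (S n)) - X (S n))
        with (- (K1 (X (S n)) (Y (S n)) - K1 (X n) (Y n))) by lra.
      replace (Y (S (S n)) - Y (S n))
        with (- (K2 (X (S n)) (Y (S n)) - K2 (X n) (Y n))) by lra.
      rewrite !Rabs_Ropp, Hpow; lra. }
  assert (Hstep : forall n k,
    Rabs (X (n + k)%nat - X n) + Rabs (Y (n + k)%nat - Y n)
      <= rho * (/ 2) ^ n * (1 - (/ 2) ^ k)).
  { intros n; induction k as [|k IH].
    - rewrite Nat.add_0_r, !Rminus_diag, Rabs_R0; simpl; lra.
    - rewrite Nat.add_succ_r.
      destruct (Inv (n + k)%nat) as [_ B]; rewrite pow_add in B.
      replace (X (S (n + k)) - X n)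
        with ((X (S (n + k)) - X (n + k)%nat) + (X (n + k)%nat - X n)) by ring.
      replace (Y (S (n + k)) - Y n)
        with ((Y (S (n + k)) - Y (n + k)%nat) + (Y (n + k)%nat - Y n)) by ring.
      pose proof (Rabs_triang (X (S (n + k)) - X (n + k)%nat) (X (n + k)%nat - X n)).
      pose proof (Rabs_triang (Y (S (n + k)) - Y (n + k)%nat) (Y (n + k)%nat - Y n)).
      rewrite Hpow; lra. }
  assert (Hsmall : forall e, 0 < e -> exists N, forall n, (N <= n)%nat -> forall k,
    Rabs (X (n + k)%nat - X n) + Rabs (Y (n + k)%nat - Y n) < e).
  { intros e He.
    (* The denominator is rho + 1 because rho may be 0. *)
    assert (He' : 0 < e / (rho + 1)) by (apply Rdiv_lt_0_compat; lra).
    destruct (pow_lt_1_zero (/ 2)) with (y := e / (rho + 1)) as [N HN];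
      [rewrite Rabs_pos_eq; lra | exact He' |].
    exists N; intros n Hn k; specialize (HN n Hn).
    rewrite Rabs_pos_eq in HN by (apply Rlt_le, Hpos).
    apply (Rmult_lt_compat_l (rho + 1)) in HN; [|lra].
    replace ((rho + 1) * (e / (rho + 1))) with e in HN by (field; lra).
    pose proof (Hstep n k); pose proof (Hpos n).
    assert (0 <= rho * (/ 2) ^ n * (/ 2) ^ k).
    { repeat apply Rmult_le_pos; auto; apply Rlt_le, Hpos. }
    lra. }
  assert (Hcauchy : Cauchy_crit X /\ Cauchy_crit Y).
  { split; intros e He; destruct (Hsmall (e / 2) ltac:(lra)) as [N HN];
    exists N; intros n m Hn Hm; unfold Rdist.
    - replace (X n - X m) with ((X n - X N) - (X m - X N)) by ring.
      pose proof (HN N (le_n N) (n - N)%nat) as Bn.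
      pose proof (HN N (le_n N) (m - N)%nat) as Bm.
      replace (N + (n - N))%nat with n in Bn by lia.
      replace (N + (m - N))%nat with m in Bm by lia.
      pose proof (Rabs_pos (Y n - Y N)); pose proof (Rabs_pos (Y m - Y N)).
      pose proof (Rabs_triang (X n - X N) (- (X m - X N))) as B.
      rewrite Rabs_Ropp in B; unfold Rminus at 1; lra.
    - replace (Y n - Y m) with ((Y n - Y N) - (Y m - Y N)) by ring.
      pose proof (HN N (le_n N) (n - N)%nat) as Bn.
      pose proof (HN N (le_n N) (m - N)%nat) as Bm.
      replace (N + (n - N))%nat with n in Bn by lia.
      replace (N + (m - N))%nat with m in Bm by lia.
      pose proof (Rabs_pos (X n - X N)); pose proof (Rabs_pos (X m - X N)).
      pose proof (Rabs_triang (Y n - Y N) (- (Y m - Y N))) as B.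
      rewrite Rabs_Ropp in B; unfold Rminus at 1; lra. }
  destruct Hcauchy as [HX HY].
  destruct (Rcomplete.R_complete X HX) as [x Lx]; destruct (Rcomplete.R_complete Y HY) as [y Ly].
  (* One index must serve for two consecutive iterates, since the residual at the limit compares
     iterate n + 1 with K at iterate n. *)
  assert (Lim : forall e, 0 < e -> exists n,
    Rabs (X n - x) + Rabs (Y n - y) < e /\ Rabs (X (S n) - x) + Rabs (Y (S n) - y) < e).
  { intros e He.
    destruct (Lx (e / 2) ltac:(lra)) as [N1 H1]; destruct (Ly (e / 2) ltac:(lra)) as [N2 H2].
    exists (N1 + N2)%nat.
    pose proof (H1 (N1 + N2)%nat ltac:(lia)); pose proof (H2 (N1 + N2)%nat ltac:(lia)).
    pose proof (H1 (S (N1 + N2)) ltac:(lia)); pose proof (H2 (S (N1 + N2)) ltac:(lia)).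
    unfold Rdist in *; lra. }
  assert (Hball : Rabs (x - x0) + Rabs (y - y0) <= rho).
  { apply le_epsilon; intros e He; destruct (Lim e He) as [n [Bn _]].
    destruct (Inv n) as [A _]; pose proof (Hpos n).
    replace (x - x0) with ((X n - x0) + - (X n - x)) by ring.
    replace (y - y0) with ((Y n - y0) + - (Y n - y)) by ring.
    pose proof (Rabs_triang (X n - x0) (- (X n - x))) as T1.
    pose proof (Rabs_triang (Y n - y0) (- (Y n - y))) as T2.
    rewrite Rabs_Ropp in T1, T2; nra. }
  assert (Hres : Rabs (x + K1 x y - w1) + Rabs (y + K2 x y - w2) <= 0).
  { apply le_epsilon; intros e He; destruct (Lim (e / 2) ltac:(lra)) as [n [Bn Bn']].
    destruct (Inv n) as [A _]; pose proof (Hpos n).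
    assert (L := Lip (X n) (Y n) x y ltac:(nra) Hball).
    replace (x + K1 x y - w1) with (- (X (S n) - x) + (K1 x y - K1 (X n) (Y n)))
      by (rewrite XS; ring).
    replace (y + K2 x y - w2) with (- (Y (S n) - y) + (K2 x y - K2 (X n) (Y n)))
      by (rewrite YS; ring).
    pose proof (Rabs_triang (- (X (S n) - x)) (K1 x y - K1 (X n) (Y n))) as T1.
    pose proof (Rabs_triang (- (Y (S n) - y)) (K2 x y - K2 (X n) (Y n))) as T2.
    rewrite Rabs_Ropp in T1, T2.
    rewrite (Rabs_minus_sym x (X n)), (Rabs_minus_sym y (Y n)) in L; lra. }
  exists x, y; split; [exact Hball|].
  pose proof (Rabs_pos (x + K1 x y - w1)); pose proof (Rabs_pos (y + K2 x y - w2)).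
  split; apply Rminus_diag_uniq, Rabs_eq_0; lra.
Qed.

(** Partial derivatives that vanish at (a, b) stay below 1/4 on a small square. The value 1/4 is
    chosen so that two such functions together have the l^1 ratio 1/2 of [contraction_solution]. *)
Lemma smooth2_flat_Lipschitz U K a b : open2 U -> U a b -> smooth2 U K ->
  pd1 K a b = 0 -> pd2 K a b = 0 ->
  exists d, 0 < d /\ subset2 (square a b d) U /\
    forall x y x' y', square a b d x y -> square a b d x' y' ->
      Rabs (K x' y' - K x y) <= / 4 * (Rabs (x' - x) + Rabs (y' - y)).
Proof.
  intros HU Hab HK K1 K2.
  destruct (open2_square_incl U a b HU Hab) as [d [Hd Ud]].
  destruct (smooth2_cont _ _ (smooth2_pd1 U K HK) a b Hab (/ 4)) as [d1 [Hd1 E1]]; [lra|].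
  destruct (smooth2_cont _ _ (smooth2_pd2 U K HK) a b Hab (/ 4)) as [d2 [Hd2 E2]]; [lra|].
  rewrite K1 in E1; rewrite K2 in E2.
  pose proof (Rmin_l d (Rmin d1 d2)); pose proof (Rmin_r d (Rmin d1 d2)).
  pose proof (Rmin_l d1 d2); pose proof (Rmin_r d1 d2).
  assert (Hm : 0 < Rmin d (Rmin d1 d2)) by (repeat apply Rmin_pos; assumption).
  set (m := Rmin d (Rmin d1 d2)) in *.
  assert (Hsub : subset2 (square a b m) U).
  { apply (subset2_trans _ _ _ (square_mono a b m d ltac:(lra)) Ud). }
  exists m; split; [exact Hm | split; [exact Hsub|]].
  intros x y x' y' [Hx Hy] [Hx' Hy'].
  assert (D := smooth2_dprim U K HK).
  destruct (MVT_segment (fun t => K t y') (fun t => pd1 K t y') x x') as [c [Hc Ec]].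
  { intros t Ht; apply (D t y'), Hsub; split; [apply (Rabs_convex a m x x' t)|]; assumption. }
  destruct (MVT_segment (fun t => K x t) (fun t => pd2 K x t) y y') as [c' [Hc' Ec']].
  { intros t Ht; apply (D x t), Hsub; split; [|apply (Rabs_convex b m y y' t)]; assumption. }
  assert (B1 : Rabs (pd1 K c y' - 0) < / 4).
  { pose proof (Rabs_convex a m x x' c Hx Hx' Hc); apply E1; lra. }
  assert (B2 : Rabs (pd2 K x c' - 0) < / 4).
  { pose proof (Rabs_convex b m y y' c' Hy Hy' Hc'); apply E2; lra. }
  rewrite Rminus_0_r in B1, B2.
  replace (K x' y' - K x y) with ((K x' y' - K x y') + (K x y' - K x y)) by ring.
  rewrite Ec, Ec'.
  eapply Rle_trans; [apply Rabs_triang|]; rewrite !Rabs_mult.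
  pose proof (Rabs_pos (x' - x)); pose proof (Rabs_pos (y' - y)); nra.
Qed.

(** The error of the linearization of f is small compared with the increments of h and k, which the
    Lipschitz bound controls by |s - t|. So the linear combination inherits the derivative of the
    composite before h or k is known to be differentiable. *)
Lemma derivable_pt_lim_linearize f h k t l1 l2 al L d :
  differentiable_pt_lim f (h t) (k t) l1 l2 ->
  derivable_pt_lim (fun s => f (h s) (k s)) t al ->
  0 < L -> 0 < d ->
  (forall s, Rabs (s - t) < d ->
     Rabs (h s - h t) + Rabs (k s - k t) <= L * Rabs (s - t)) ->
  derivable_pt_lim (fun s => l1 * h s + l2 * k s) t al.
Proof.
  intros Hf Hal HL Hd Lip eps Heps.
  assert (He1 : 0 < eps / 2 / L) by (apply Rdiv_lt_0_compat; lra).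
  destruct (Hf (mkposreal _ He1)) as [e1 E1]; simpl in E1.
  destruct (Hal (eps / 2) ltac:(lra)) as [e2 E2].
  pose proof (cond_pos e1) as P1; pose proof (cond_pos e2) as P2.
  assert (Hm : 0 < Rmin d (Rmin (e1 / L) e2)).
  { repeat apply Rmin_pos; auto; apply Rdiv_lt_0_compat; lra. }
  exists (mkposreal _ Hm); simpl; intros s Hs0 Hs.
  pose proof (Rmin_l d (Rmin (e1 / L) e2)); pose proof (Rmin_r d (Rmin (e1 / L) e2)).
  pose proof (Rmin_l (e1 / L) e2); pose proof (Rmin_r (e1 / L) e2).
  specialize (E2 s Hs0 ltac:(lra)).
  specialize (Lip (t + s)); replace (t + s - t) with s in Lip by ring.
  specialize (Lip ltac:(lra)).
  assert (Hs1 : L * Rabs s < e1).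
  { apply (Rmult_lt_reg_l (/ L)); [apply Rinv_0_lt_compat, HL|].
    replace (/ L * (L * Rabs s)) with (Rabs s) by (field; lra).
    replace (/ L * e1) with (e1 / L) by (unfold Rdiv; ring); lra. }
  pose proof (Rabs_pos (h (t + s) - h t)); pose proof (Rabs_pos (k (t + s) - k t)).
  specialize (E1 (h (t + s)) (k (t + s)) ltac:(lra) ltac:(lra)).
  assert (Hmax : Rmax (Rabs (h (t + s) - h t)) (Rabs (k (t + s) - k t)) <= L * Rabs s).
  { apply Rmax_lub; lra. }
  assert (B1 : Rabs (f (h (t + s)) (k (t + s)) - f (h t) (k t)
     - (l1 * (h (t + s) - h t) + l2 * (k (t + s) - k t))) <= eps / 2 * Rabs s).
  { eapply Rle_trans; [exact E1|].
    replace (eps / 2 * Rabs s) with (eps / 2 / L * (L * Rabs s)) by (field; lra).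
    apply Rmult_le_compat_l; lra. }
  set (F := f (h (t + s)) (k (t + s)) - f (h t) (k t)) in *.
  set (M := l1 * (h (t + s) - h t) + l2 * (k (t + s) - k t)) in *.
  assert (Hsp : 0 < Rabs s) by (apply Rabs_pos_lt, Hs0).
  replace ((l1 * h (t + s) + l2 * k (t + s) - (l1 * h t + l2 * k t)) / s - al)
    with ((F / s - al) + - ((F - M) / s)) by (unfold M; field; exact Hs0).
  eapply Rle_lt_trans; [apply Rabs_triang|]; rewrite Rabs_Ropp.
  assert (Rabs ((F - M) / s) <= eps / 2).
  { unfold Rdiv at 1; rewrite Rabs_mult, Rabs_inv.
    apply (Rmult_le_reg_r (Rabs s)); [exact Hsp|].
    rewrite Rmult_assoc, Rinv_l, Rmult_1_r by lra; exact B1. }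
  lra.
Qed.

(** Two linearized equations with invertible matrix: by Cramer's rule h and k are themselves
    combinations of the two functions whose derivatives [derivable_pt_lim_linearize] provides. *)
Lemma derivable_pt_lim_inverse f1 f2 h k t a11 a12 a21 a22 al be L d :
  differentiable_pt_lim f1 (h t) (k t) a11 a12 ->
  differentiable_pt_lim f2 (h t) (k t) a21 a22 ->
  a11 * a22 - a12 * a21 <> 0 ->
  derivable_pt_lim (fun s => f1 (h s) (k s)) t al ->
  derivable_pt_lim (fun s => f2 (h s) (k s)) t be ->
  0 < L -> 0 < d ->
  (forall s, Rabs (s - t) < d ->
     Rabs (h s - h t) + Rabs (k s - k t) <= L * Rabs (s - t)) ->
  derivable_pt_lim h t ((a22 * al - a12 * be) / (a11 * a22 - a12 * a21)) /\
  derivable_pt_lim k t ((a11 * be - a21 * al) / (a11 * a22 - a12 * a21)).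
Proof.
  intros F1 F2 HD A1 A2 HL Hd Lip.
  assert (B1 := derivable_pt_lim_linearize f1 h k t a11 a12 al L d F1 A1 HL Hd Lip).
  assert (B2 := derivable_pt_lim_linearize f2 h k t a21 a22 be L d F2 A2 HL Hd Lip).
  set (D := a11 * a22 - a12 * a21) in *.
  assert (Comb : forall c1 c2, derivable_pt_lim
    (fun s => c1 * (a11 * h s + a12 * k s) + c2 * (a21 * h s + a22 * k s)) t
    (c1 * al + c2 * be)).
  { intros c1 c2.
    apply (derivable_pt_lim_plus (fun s => c1 * (a11 * h s + a12 * k s))
             (fun s => c2 * (a21 * h s + a22 * k s))).
    - apply (derivable_pt_lim_scal (fun s => a11 * h s + a12 * k s)), B1.
    - apply (derivable_pt_lim_scal (fun s => a21 * h s + a22 * k s)), B2. }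
  split.
  - refine (derivable_pt_lim_ext_loc _ _ _ _ 1 Rlt_0_1 _
              (derivable_pt_lim_value _ _ _ _ (Comb (a22 / D) (- a12 / D)) _)).
    + intros s _; unfold D in *; field; exact HD.
    + field; exact HD.
  - refine (derivable_pt_lim_ext_loc _ _ _ _ 1 Rlt_0_1 _
              (derivable_pt_lim_value _ _ _ _ (Comb (- a21 / D) (a11 / D)) _)).
    + intros s _; unfold D in *; field; exact HD.
    + field; exact HD.
Qed.

(** * Regularity of a Lipschitz inverse *)

Section LipschitzInverse.

Variables (A B : R -> R -> Prop) (f1 f2 g1 g2 : R -> R -> R) (L : R).
Hypothesis openA : open2 A.
Hypothesis openB : open2 B.
Hypothesis smooth_f1 : smooth2 A f1.
Hypothesis smooth_f2 : smooth2 A f2.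
Hypothesis Jac_f : forall x y, A x y -> Jac f1 f2 x y <> 0.
Hypothesis inverse : forall c e, B c e ->
  A (g1 c e) (g2 c e) /\ f1 (g1 c e) (g2 c e) = c /\ f2 (g1 c e) (g2 c e) = e.
Hypothesis L_pos : 0 < L.
Hypothesis Lipschitz_g : forall c e c' e', B c e -> B c' e' ->
  Rabs (g1 c' e' - g1 c e) + Rabs (g2 c' e' - g2 c e)
    <= L * (Rabs (c' - c) + Rabs (e' - e)).

Lemma inverse_cont2 : cont2_on B g1 /\ cont2_on B g2.
Proof.
  assert (H : forall c e, B c e -> forall eps, 0 < eps -> exists d, 0 < d /\
    forall c' e', Rabs (c' - c) < d -> Rabs (e' - e) < d ->
      Rabs (g1 c' e' - g1 c e) + Rabs (g2 c' e' - g2 c e) < eps).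
  { intros c e Hce eps Heps.
    destruct (openB c e Hce) as [d [Hd Bd]].
    assert (Hq : 0 < eps / (2 * L)) by (apply Rdiv_lt_0_compat; lra).
    exists (Rmin d (eps / (2 * L))); split; [apply Rmin_pos; assumption|].
    intros c' e' Hc He.
    pose proof (Rmin_l d (eps / (2 * L))); pose proof (Rmin_r d (eps / (2 * L))).
    eapply Rle_lt_trans; [apply Lipschitz_g; [exact Hce | apply Bd; lra]|].
    replace eps with (L * (eps / (2 * L) + eps / (2 * L))) by (field; lra).
    apply Rmult_lt_compat_l; lra. }
  split; intros c e Hce eps Heps; destruct (H c e Hce eps Heps) as [d [Hd E]];
    exists d; (split; [exact Hd|]); intros c' e' Hc He; specialize (E c' e' Hc He);
    pose proof (Rabs_pos (g1 c' e' - g1 c e));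
    pose proof (Rabs_pos (g2 c' e' - g2 c e)); lra.
Qed.

Lemma inverse_dprim :
  dprim B g1 (fun c e => pd2 f2 (g1 c e) (g2 c e) / Jac f1 f2 (g1 c e) (g2 c e),
              fun c e => - pd2 f1 (g1 c e) (g2 c e) / Jac f1 f2 (g1 c e) (g2 c e)) /\
  dprim B g2 (fun c e => - pd1 f2 (g1 c e) (g2 c e) / Jac f1 f2 (g1 c e) (g2 c e),
              fun c e => pd1 f1 (g1 c e) (g2 c e) / Jac f1 f2 (g1 c e) (g2 c e)).
Proof.
  assert (H : forall c e, B c e ->
    (derivable_pt_lim (fun t => g1 t e) c
       (pd2 f2 (g1 c e) (g2 c e) / Jac f1 f2 (g1 c e) (g2 c e)) /\
     derivable_pt_lim (fun t => g2 t e) c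
       (- pd1 f2 (g1 c e) (g2 c e) / Jac f1 f2 (g1 c e) (g2 c e))) /\
    (derivable_pt_lim (fun t => g1 c t) e
       (- pd2 f1 (g1 c e) (g2 c e) / Jac f1 f2 (g1 c e) (g2 c e)) /\
     derivable_pt_lim (fun t => g2 c t) e
       (pd1 f1 (g1 c e) (g2 c e) / Jac f1 f2 (g1 c e) (g2 c e)))).
  { intros c e Hce.
    destruct (inverse c e Hce) as [HA _].
    assert (F : forall f, smooth2 A f -> differentiable_pt_lim f (g1 c e) (g2 c e)
      (pd1 f (g1 c e) (g2 c e)) (pd2 f (g1 c e) (g2 c e))).
    { intros f Hf.
      apply (dprim_differentiable A f (pd1 f, pd2 f)); auto using smooth2_dprim;
        apply (cont2_on_continuity_2d A); auto; apply smooth2_cont; cbn [fst snd];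
        auto using smooth2_pd1, smooth2_pd2. }
    destruct (openB c e Hce) as [d [Hd Bd]].
    assert (Z : forall x, Rabs (x - x) = 0) by (intros x; rewrite Rminus_diag; apply Rabs_R0).
    assert (HJ := Jac_f _ _ HA); unfold Jac in HJ |- *.
    split.
    (* Along the first axis f1(g) is the running variable and f2(g) is constant, whence the
       derivatives 1 and 0; along the second axis the roles are exchanged. *)
    - destruct (derivable_pt_lim_inverse f1 f2 (fun t => g1 t e) (fun t => g2 t e) c
        _ _ _ _ 1 0 L d (F f1 smooth_f1) (F f2 smooth_f2) HJ) as [D1 D2].
      + apply (derivable_pt_lim_ext_loc (fun s => s) _ _ _ d Hd);
          [|apply derivable_pt_lim_id].
        intros s Hs; symmetry; apply inverse, Bd; [exact Hs | apply Rabs_0_lt, Hd].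
      + apply (derivable_pt_lim_ext_loc (fun s => e) _ _ _ d Hd);
          [|apply derivable_pt_lim_const].
        intros s Hs; symmetry; apply inverse, Bd; [exact Hs | apply Rabs_0_lt, Hd].
      + exact L_pos.
      + exact Hd.
      + intros s Hs.
        assert (Hse : B s e) by (apply Bd; [exact Hs | apply Rabs_0_lt, Hd]).
        pose proof (Lipschitz_g c e s e Hce Hse) as B0; rewrite Z in B0; lra.
      + split; eapply derivable_pt_lim_value; try eassumption; field; exact HJ.
    - destruct (derivable_pt_lim_inverse f1 f2 (fun t => g1 c t) (fun t => g2 c t) e
        _ _ _ _ 0 1 L d (F f1 smooth_f1) (F f2 smooth_f2) HJ) as [D1 D2].
      + apply (derivable_pt_lim_ext_loc (fun s => c) _ _ _ d Hd);
          [|apply derivable_pt_lim_const].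
        intros s Hs; symmetry; apply inverse, Bd; [apply Rabs_0_lt, Hd | exact Hs].
      + apply (derivable_pt_lim_ext_loc (fun s => s) _ _ _ d Hd);
          [|apply derivable_pt_lim_id].
        intros s Hs; symmetry; apply inverse, Bd; [apply Rabs_0_lt, Hd | exact Hs].
      + exact L_pos.
      + exact Hd.
      + intros s Hs.
        assert (Hse : B c s) by (apply Bd; [apply Rabs_0_lt, Hd | exact Hs]).
        pose proof (Lipschitz_g c e c s Hce Hse) as B0; rewrite Z in B0; lra.
      + split; eapply derivable_pt_lim_value; try eassumption; field; exact HJ. }
  split; intros c e Hce; destruct (H c e Hce) as [[? ?] [? ?]]; split; assumption.
Qed.

(** Bootstrap: the partial derivatives of g1, g2 are smooth functions on A evaluated at (g1, g2), so
    class C^k of the inverse gives class C^(k+1). The Lipschitz bound starts the induction. *)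
Lemma inverse_smooth2 : smooth2 B g1 /\ smooth2 B g2.
Proof.
  destruct inverse_dprim as [D1 D2].
  assert (SJ := smooth2_Jac A f1 f2 openA smooth_f1 smooth_f2).
  assert (H : forall k, Ck2 B k g1 /\ Ck2 B k g2).
  { induction k as [|k [IH1 IH2]]; [exact inverse_cont2|].
    assert (Q : forall h, smooth2 A h -> Ck2 B k
      (fun c e => h (g1 c e) (g2 c e) / Jac f1 f2 (g1 c e) (g2 c e))).
    { intros h Hh.
      apply (Ck2_comp2 B A k (fun x y => h x y / Jac f1 f2 x y)); auto.
      - apply smooth2_div; auto.
      - intros c e Hce; apply inverse, Hce. }
    split.
    - apply (Ck2_intro B k g1 _ openB D1); cbn [fst snd].
      + apply Q, smooth2_pd2, smooth_f2.
      + apply (Q (fun x y => - pd2 f1 x y)), smooth2_opp, smooth2_pd2; assumption.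
    - apply (Ck2_intro B k g2 _ openB D2); cbn [fst snd].
      + apply (Q (fun x y => - pd1 f2 x y)), smooth2_opp, smooth2_pd1; assumption.
      + apply Q, smooth2_pd1, smooth_f1. }
  split; intros k; apply H.
Qed.

End LipschitzInverse.

(* With A the derivative at (a, b), the map A^-1 (f1, f2) is the identity plus a
   1/2-Lipschitz perturbation (K1, K2) near (a, b), for the l^1 distance. *)
Lemma inverse_function_theorem U f1 f2 a b :
  open2 U -> U a b -> smooth2 U f1 -> smooth2 U f2 -> Jac f1 f2 a b <> 0 ->
  exists (A B : R -> R -> Prop) (g1 g2 : R -> R -> R),
    subset2 A U /\ A a b /\ diffeo A B f1 f2 g1 g2.
Proof.
  intros HU Hab S1 S2 HJ.
  set (D := Jac f1 f2 a b) in *.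
  set (a11 := pd1 f1 a b); set (a12 := pd2 f1 a b).
  set (a21 := pd1 f2 a b); set (a22 := pd2 f2 a b).
  assert (ED : D = a11 * a22 - a12 * a21) by reflexivity.
  set (K1 := fun x y => a22 / D * f1 x y + - a12 / D * f2 x y - x).
  set (K2 := fun x y => - a21 / D * f1 x y + a11 / D * f2 x y - y).
  assert (SK : forall c1 c2 h, smooth2 U h ->
    smooth2 U (fun x y => c1 * f1 x y + c2 * f2 x y - h x y)).
  { intros c1 c2 h Hh; apply smooth2_minus; auto; apply smooth2_plus; auto;
      apply smooth2_mult; auto using smooth2_const. }
  assert (SK1 : smooth2 U K1) by (apply SK; intros k; apply Ck2_fst, HU).
  assert (SK2 : smooth2 U K2) by (apply SK; intros k; apply Ck2_snd, HU).
  assert (DK : forall c1 c2 h v, dprim U h v ->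
    dprim U (fun x y => c1 * f1 x y + c2 * f2 x y - h x y)
      (fun x y => c1 * pd1 f1 x y + c2 * pd1 f2 x y - fst v x y,
       fun x y => c1 * pd2 f1 x y + c2 * pd2 f2 x y - snd v x y)).
  { intros c1 c2 h v Hv.
    eapply dprim_value.
    - apply dprim_minus; [|exact Hv].
      apply dprim_plus; apply dprim_mult;
        [apply dprim_const | apply smooth2_dprim, S1
        |apply dprim_const | apply smooth2_dprim, S2].
    - intros x y _; cbn [fst snd]; split; ring. }
  assert (DK1 := DK (a22 / D) (- a12 / D) _ _ (dprim_fst U)).
  assert (DK2 := DK (- a21 / D) (a11 / D) _ _ (dprim_snd U)).
  assert (HD : a11 * a22 - a12 * a21 <> 0) by (rewrite <- ED; exact HJ).
  destruct (smooth2_flat_Lipschitz U K1 a b HU Hab SK1) as [d1 [Hd1 [_ L1]]].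
  { unfold K1; rewrite (dprim_pd1 U _ _ a b DK1 Hab); cbn [fst snd].
    fold a11 a21; rewrite ED; field; exact HD. }
  { unfold K1; rewrite (dprim_pd2 U _ _ a b DK1 Hab); cbn [fst snd].
    fold a12 a22; rewrite ED; field; exact HD. }
  destruct (smooth2_flat_Lipschitz U K2 a b HU Hab SK2) as [d2 [Hd2 [_ L2]]].
  { unfold K2; rewrite (dprim_pd1 U _ _ a b DK2 Hab); cbn [fst snd].
    fold a11 a21; rewrite ED; field; exact HD. }
  { unfold K2; rewrite (dprim_pd2 U _ _ a b DK2 Hab); cbn [fst snd].
    fold a12 a22; rewrite ED; field; exact HD. }
  assert (SJ := smooth2_Jac U f1 f2 HU S1 S2).
  (* Squaring makes the Jacobian positive whatever its sign, so a positivity lemma keeps it nonzero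
     nearby. *)
  destruct (cont2_pos_square U (fun x y => Jac f1 f2 x y * Jac f1 f2 x y) a b)
    as [d3 [Hd3 [Ud3 J3]]]; auto.
  { apply smooth2_cont, smooth2_mult; auto. }
  { fold D; nra. }
  assert (Hd : 0 < Rmin d3 (Rmin d1 d2)) by (repeat apply Rmin_pos; assumption).
  set (d := Rmin d3 (Rmin d1 d2)) in *.
  assert (Dd : d <= d1 /\ d <= d2 /\ d <= d3).
  { pose proof (Rmin_l d3 (Rmin d1 d2)); pose proof (Rmin_r d3 (Rmin d1 d2)).
    pose proof (Rmin_l d1 d2); pose proof (Rmin_r d1 d2); unfold d; lra. }
  set (A := square a b d).
  assert (HAU : subset2 A U).
  { apply (subset2_trans _ _ _ (square_mono a b d d3 ltac:(lra)) Ud3). }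
  assert (JA : forall x y, A x y -> Jac f1 f2 x y <> 0).
  { intros x y Hxy E; specialize (J3 x y (square_mono a b d d3 ltac:(lra) x y Hxy)).
    rewrite E in J3; lra. }
  assert (Lip : forall x y x' y', A x y -> A x' y' ->
    Rabs (K1 x' y' - K1 x y) + Rabs (K2 x' y' - K2 x y)
      <= / 2 * (Rabs (x' - x) + Rabs (y' - y))).
  { intros x y x' y' H H'.
    specialize (L1 x y x' y' (square_mono a b d d1 ltac:(lra) x y H)
                  (square_mono a b d d1 ltac:(lra) x' y' H')).
    specialize (L2 x y x' y' (square_mono a b d d2 ltac:(lra) x y H)
                  (square_mono a b d d2 ltac:(lra) x' y' H')).
    lra. }
  (* The sum of the absolute values of the entries bounds the l^1 norm of the inverse Jacobian
     matrix at (a, b); the summand 1 makes M positive. *)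
  set (M := Rabs (a22 / D) + Rabs (- a12 / D) + Rabs (- a21 / D) + Rabs (a11 / D) + 1).
  assert (HM : 0 < M).
  { pose proof (Rabs_pos (a22 / D)); pose proof (Rabs_pos (- a12 / D)).
    pose proof (Rabs_pos (- a21 / D)); pose proof (Rabs_pos (a11 / D)); unfold M; lra. }
  assert (Bound : forall s t,
    Rabs (a22 / D * s + - a12 / D * t) + Rabs (- a21 / D * s + a11 / D * t)
      <= M * (Rabs s + Rabs t)).
  { intros s t.
    pose proof (Rabs_triang (a22 / D * s) (- a12 / D * t)).
    pose proof (Rabs_triang (- a21 / D * s) (a11 / D * t)).
    rewrite !Rabs_mult in *.
    pose proof (Rabs_pos (a22 / D)); pose proof (Rabs_pos (- a12 / D)).
    pose proof (Rabs_pos (- a21 / D)); pose proof (Rabs_pos (a11 / D)).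
    pose proof (Rabs_pos s); pose proof (Rabs_pos t); unfold M; nra. }
  (* The identity plus a 1/2-Lipschitz map shrinks distances at most by half. This gives both the
     injectivity of (f1, f2) on A and the Lipschitz constant 2 M of the inverse. *)
  assert (Expand : forall x y x' y', A x y -> A x' y' ->
    Rabs (x' - x) + Rabs (y' - y)
      <= 2 * M * (Rabs (f1 x' y' - f1 x y) + Rabs (f2 x' y' - f2 x y))).
  { intros x y x' y' H H'.
    pose proof (Lip x y x' y' H H') as LL.
    pose proof (Bound (f1 x' y' - f1 x y) (f2 x' y' - f2 x y)) as BB.
    replace (a22 / D * (f1 x' y' - f1 x y) + - a12 / D * (f2 x' y' - f2 x y))
      with ((x' - x) + (K1 x' y' - K1 x y)) in BB by (unfold K1; ring).
    replace (- a21 / D * (f1 x' y' - f1 x y) + a11 / D * (f2 x' y' - f2 x y))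
      with ((y' - y) + (K2 x' y' - K2 x y)) in BB by (unfold K2; ring).
    pose proof (Rabs_triang_inv (x' - x) (- (K1 x' y' - K1 x y))) as T1.
    pose proof (Rabs_triang_inv (y' - y) (- (K2 x' y' - K2 x y))) as T2.
    rewrite Rabs_Ropp in T1, T2; unfold Rminus at 1 in T1; unfold Rminus at 1 in T2.
    replace (x' - x - - (K1 x' y' - K1 x y)) with ((x' - x) + (K1 x' y' - K1 x y))
      in T1 by ring.
    replace (y' - y - - (K2 x' y' - K2 x y)) with ((y' - y) + (K2 x' y' - K2 x y))
      in T2 by ring.
    lra. }
  assert (HA : open2 A) by apply open2_square.
  set (B := fun c e => exists x y, A x y /\ f1 x y = c /\ f2 x y = e).
  assert (HB : open2 B).
  { intros c e [x [y [Hxy [<- <-]]]].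
    destruct (open2_square_incl A x y HA Hxy) as [r [Hr Ur]].
    (* The closed l^1 ball of radius r / 2 lies in the square of size r. A target within r / (8 M)
       in each coordinate displaces the start by at most M (2 r / (8 M)) = r / 4, half that radius,
       as the contraction argument requires. *)
    assert (Hq : 0 < r / (8 * M)) by (apply Rdiv_lt_0_compat; lra).
    exists (r / (8 * M)); split; [exact Hq|]; intros c e Hc He.
    destruct (contraction_solution K1 K2 x y (a22 / D * c + - a12 / D * e)
                (- a21 / D * c + a11 / D * e) (r / 2)) as [x' [y' [Hb [E1 E2]]]].
    - intros u v u' v' H H'; apply Lip; apply Ur;
        pose proof (Rabs_pos (u - x)); pose proof (Rabs_pos (v - y));
        pose proof (Rabs_pos (u' - x)); pose proof (Rabs_pos (v' - y)); split; lra.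
    - pose proof (Bound (c - f1 x y) (e - f2 x y)) as BB.
      replace (a22 / D * c + - a12 / D * e - K1 x y - x)
        with (a22 / D * (c - f1 x y) + - a12 / D * (e - f2 x y)) by (unfold K1; ring).
      replace (- a21 / D * c + a11 / D * e - K2 x y - y)
        with (- a21 / D * (c - f1 x y) + a11 / D * (e - f2 x y)) by (unfold K2; ring).
      eapply Rle_trans; [exact BB|].
      replace (r / 2 / 2) with (M * (r / (8 * M) + r / (8 * M))) by (field; lra).
      apply Rmult_le_compat_l; lra.
    - exists x', y'; split.
      + apply Ur; pose proof (Rabs_pos (x' - x)); pose proof (Rabs_pos (y' - y)); split; lra.
      + unfold K1 in E1; unfold K2 in E2.
        assert (E1' : a22 / D * (f1 x' y' - c) + - a12 / D * (f2 x' y' - e) = 0) by lra.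
        assert (E2' : - a21 / D * (f1 x' y' - c) + a11 / D * (f2 x' y' - e) = 0) by lra.
        (* Applying the Jacobian matrix at (a, b) undoes its inverse and leaves f1 = c and f2 =
           e. *)
        split; apply Rminus_diag_uniq.
        * replace (f1 x' y' - c) with
            (a11 * (a22 / D * (f1 x' y' - c) + - a12 / D * (f2 x' y' - e))
             + a12 * (- a21 / D * (f1 x' y' - c) + a11 / D * (f2 x' y' - e)))
            by (rewrite ED; field; exact HD).
          rewrite E1', E2'; ring.
        * replace (f2 x' y' - e) with
            (a21 * (a22 / D * (f1 x' y' - c) + - a12 / D * (f2 x' y' - e))
             + a22 * (- a21 / D * (f1 x' y' - c) + a11 / D * (f2 x' y' - e)))
            by (rewrite ED; field; exact HD).
          rewrite E1', E2'; ring. }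
  (* Choice selects a preimage in A of each point of the image B; the pair (0, 0) only witnesses
     that the type is inhabited. *)
  set (sel := fun c e => epsilon (inhabits (0, 0)) (fun z : R * R =>
    A (fst z) (snd z) /\ f1 (fst z) (snd z) = c /\ f2 (fst z) (snd z) = e)).
  set (g1 := fun c e => fst (sel c e)); set (g2 := fun c e => snd (sel c e)).
  assert (Inv : forall c e, B c e ->
    A (g1 c e) (g2 c e) /\ f1 (g1 c e) (g2 c e) = c /\ f2 (g1 c e) (g2 c e) = e).
  { intros c e [x [y H]]; unfold g1, g2, sel.
    apply (epsilon_spec (inhabits (0, 0)) (fun z : R * R =>
      A (fst z) (snd z) /\ f1 (fst z) (snd z) = c /\ f2 (fst z) (snd z) = e)).
    exists (x, y); exact H. }
  assert (LipG : forall c e c' e', B c e -> B c' e' ->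
    Rabs (g1 c' e' - g1 c e) + Rabs (g2 c' e' - g2 c e)
      <= 2 * M * (Rabs (c' - c) + Rabs (e' - e))).
  { intros c e c' e' H H'.
    destruct (Inv c e H) as [I0 [I1 I2]], (Inv c' e' H') as [I0' [I1' I2']].
    pose proof (Expand _ _ _ _ I0 I0') as EE; rewrite I1, I2, I1', I2' in EE; exact EE. }
  assert (SA1 := smooth2_subset U A f1 HAU S1); assert (SA2 := smooth2_subset U A f2 HAU S2).
  destruct (inverse_smooth2 A B f1 f2 g1 g2 (2 * M) HA HB SA1 SA2 JA Inv
              ltac:(lra) LipG) as [SG1 SG2].
  exists A, B, g1, g2; split; [exact HAU | split; [apply square_center, Hd|]].
  repeat split; try assumption; try (apply Inv; assumption).
  - exists a0, b0; auto.
  (* The chosen preimage of the image of a point has the same image as that point, so [Expand] puts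
     them at distance 0. *)
  - destruct (Inv (f1 a0 b0) (f2 a0 b0)) as [I0 [I1 I2]]; [exists a0, b0; auto|].
    pose proof (Expand _ _ _ _ H I0) as EE; rewrite I1, I2, !Rminus_diag, Rabs_R0 in EE.
    pose proof (Rabs_pos (g1 (f1 a0 b0) (f2 a0 b0) - a0)).
    pose proof (Rabs_pos (g2 (f1 a0 b0) (f2 a0 b0) - b0)).
    apply Rminus_diag_uniq, Rabs_eq_0; lra.
  - destruct (Inv (f1 a0 b0) (f2 a0 b0)) as [I0 [I1 I2]]; [exists a0, b0; auto|].
    pose proof (Expand _ _ _ _ H I0) as EE; rewrite I1, I2, !Rminus_diag, Rabs_R0 in EE.
    pose proof (Rabs_pos (g1 (f1 a0 b0) (f2 a0 b0) - a0)).
    pose proof (Rabs_pos (g2 (f1 a0 b0) (f2 a0 b0) - b0)).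
    apply Rminus_diag_uniq, Rabs_eq_0; lra.
Qed.

(** * Jacobian matrices of a diffeomorphism and its inverse *)

Lemma diffeo_sym A B x1 x2 y1 y2 : diffeo A B x1 x2 y1 y2 -> diffeo B A y1 y2 x1 x2.
Proof. intros [? [? [? [? [? [? [? ?]]]]]]]; repeat split; try assumption; firstorder. Qed.

Lemma diffeo_pd A B x1 x2 y1 y2 a b : diffeo A B x1 x2 y1 y2 -> A a b ->
  let c := x1 a b in let e := x2 a b in
  pd1 y1 c e * pd1 x1 a b + pd2 y1 c e * pd1 x2 a b = 1 /\
  pd1 y1 c e * pd2 x1 a b + pd2 y1 c e * pd2 x2 a b = 0 /\
  pd1 y2 c e * pd1 x1 a b + pd2 y2 c e * pd1 x2 a b = 0 /\
  pd1 y2 c e * pd2 x1 a b + pd2 y2 c e * pd2 x2 a b = 1.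
Proof.
  intros [HA [HB [S1 [S2 [T1 [T2 [HAB _]]]]]]] Hab; cbn zeta.
  assert (Hm : forall x y, A x y -> B (x1 x y) (x2 x y)) by (intros; apply HAB; assumption).
  assert (D1 := smooth2_comp2_dprim A B y1 x1 x2 HA HB T1 S1 S2 Hm).
  assert (D2 := smooth2_comp2_dprim A B y2 x1 x2 HA HB T2 S1 S2 Hm).
  assert (E1 := dprim_ext A _ (fun x _ => x) _ HA (fun x y H => proj1 (proj2 (HAB x y H))) D1).
  assert (E2 := dprim_ext A _ (fun _ y => y) _ HA (fun x y H => proj2 (proj2 (HAB x y H))) D2).
  assert (P1 := dprim_pd1 A _ _ a b E1 Hab); assert (P2 := dprim_pd2 A _ _ a b E1 Hab).
  assert (P3 := dprim_pd1 A _ _ a b E2 Hab); assert (P4 := dprim_pd2 A _ _ a b E2 Hab).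
  cbn [fst snd] in P1, P2, P3, P4; rewrite <- P1, <- P2, <- P3, <- P4.
  rewrite (dprim_pd1 A _ _ a b (dprim_fst A) Hab), (dprim_pd2 A _ _ a b (dprim_fst A) Hab).
  rewrite (dprim_pd1 A _ _ a b (dprim_snd A) Hab), (dprim_pd2 A _ _ a b (dprim_snd A) Hab).
  cbn [fst snd]; auto.
Qed.

(** By [diffeo_pd] the two Jacobian matrices multiply to the identity. Determinants show that D is
    nonzero, and Cramer's rule gives the entries of the inverse. *)
Lemma diffeo_inverse_pd A B x1 x2 y1 y2 a b : diffeo A B x1 x2 y1 y2 -> A a b ->
  let c := x1 a b in let e := x2 a b in let D := Jac x1 x2 a b in
  D <> 0 /\
  pd1 y1 c e = pd2 x2 a b / D /\ pd2 y1 c e = - pd2 x1 a b / D /\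
  pd1 y2 c e = - pd1 x2 a b / D /\ pd2 y2 c e = pd1 x1 a b / D.
Proof.
  intros Hd Hab; destruct (diffeo_pd A B x1 x2 y1 y2 a b Hd Hab) as [E1 [E2 [E3 E4]]].
  cbv zeta; set (c := x1 a b) in *; set (e := x2 a b) in *; unfold Jac.
  set (x11 := pd1 x1 a b) in *; set (x12 := pd2 x1 a b) in *.
  set (x21 := pd1 x2 a b) in *; set (x22 := pd2 x2 a b) in *.
  set (y11 := pd1 y1 c e) in *; set (y12 := pd2 y1 c e) in *.
  set (y21 := pd1 y2 c e) in *; set (y22 := pd2 y2 c e) in *.
  assert (ED : (x11 * x22 - x12 * x21) * (y11 * y22 - y12 * y21) = 1).
  { transitivity ((y11 * x11 + y12 * x21) * (y21 * x12 + y22 * x22)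
      - (y11 * x12 + y12 * x22) * (y21 * x11 + y22 * x21)); [ring|].
    rewrite E1, E2, E3, E4; ring. }
  assert (HD : x11 * x22 - x12 * x21 <> 0).
  { intros E; rewrite E in ED; lra. }
  assert (Q : forall t s, t * (x11 * x22 - x12 * x21) = s -> t = s / (x11 * x22 - x12 * x21)).
  { intros t s <-; field; exact HD. }
  split; [exact HD | repeat split; apply Q].
  - transitivity (x22 * (y11 * x11 + y12 * x21) - x21 * (y11 * x12 + y12 * x22)); [ring|].
    rewrite E1, E2; ring.
  - transitivity (x11 * (y11 * x12 + y12 * x22) - x12 * (y11 * x11 + y12 * x21)); [ring|].
    rewrite E1, E2; ring.
  - transitivity (x22 * (y21 * x11 + y22 * x21) - x21 * (y21 * x12 + y22 * x22)); [ring|].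
    rewrite E3, E4; ring.
  - transitivity (x11 * (y21 * x12 + y22 * x22) - x12 * (y21 * x11 + y22 * x21)); [ring|].
    rewrite E3, E4; ring.
Qed.

(** * Convexity *)

(** The slopes of phi over [0, l] and [l, 1] are values of phi1 at points c < c', and phi1 increases
    because phi2 is positive. *)
Lemma strictly_convex_segment phi phi1 phi2 :
  (forall t, 0 <= t <= 1 -> derivable_pt_lim phi t (phi1 t)) ->
  (forall t, 0 <= t <= 1 -> derivable_pt_lim phi1 t (phi2 t)) ->
  (forall t, 0 <= t <= 1 -> 0 < phi2 t) ->
  forall l, 0 < l < 1 -> phi l < l * phi 1 + (1 - l) * phi 0.
Proof.
  intros D1 D2 Hpos l Hl.
  destruct (MVT_cor2 phi phi1 0 l) as [c [Ec Hc]]; [lra | intros; apply D1; lra |].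
  destruct (MVT_cor2 phi phi1 l 1) as [c' [Ec' Hc']]; [lra | intros; apply D1; lra |].
  destruct (MVT_cor2 phi1 phi2 c c') as [m [Em Hm]]; [lra | intros; apply D2; lra |].
  assert (0 < phi2 m * (c' - c)) by (apply Rmult_lt_0_compat; [apply Hpos|]; lra).
  (* This product equals l phi(1) + (1 - l) phi(0) - phi(l). *)
  assert (0 < l * (1 - l) * (phi1 c' - phi1 c)).
  { rewrite Em; repeat apply Rmult_lt_0_compat; try lra; apply Hpos; lra. }
  nra.
Qed.

Lemma quadratic_form_pos A B C x y :
  0 < A -> 0 < A * C - B * B -> x <> 0 \/ y <> 0 ->
  0 < A * x * x + 2 * B * x * y + C * y * y.
Proof.
  intros HA HD Hxy.
  apply (Rmult_lt_reg_l A); [exact HA|]; rewrite Rmult_0_r.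
  replace (A * (A * x * x + 2 * B * x * y + C * y * y))
    with (Rsqr (A * x + B * y) + (A * C - B * B) * Rsqr y) by (unfold Rsqr; ring).
  destruct (Req_dec y 0) as [->|Hy].
  - destruct Hxy as [Hx|Hx]; [|contradiction].
    assert (0 < Rsqr (A * x + B * 0)).
    { apply Rsqr_pos_lt; rewrite Rmult_0_r, Rplus_0_r.
      apply Rmult_integral_contrapositive; split; lra. }
    unfold Rsqr at 2; lra.
  - pose proof (Rle_0_sqr (A * x + B * y)); pose proof (Rsqr_pos_lt y Hy); nra.
Qed.

Lemma derivable_pt_lim_affine a b t : derivable_pt_lim (fun l => l * a + (1 - l) * b) t (a - b).
Proof. apply is_derive_Reals; auto_derive; [exact I | ring]. Qed.

(** Along a segment the second derivative of u is the Hessian form in the direction of the segment,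
    which is positive definite because u_11 and the determinant are positive. *)
Lemma strictly_convex_of_hessian V u : open2 V -> smooth2 V u ->
  (forall x y, V x y -> 0 < pd1 (pd1 u) x y) -> (forall x y, V x y -> 0 < Jdet u x y) ->
  strictly_convex_on V u.
Proof.
  intros HV Su H11 HJ a1 a2 b1 b2 Hne Hseg l Hl.
  set (h := fun l => l * a1 + (1 - l) * b1) in *.
  set (k := fun l => l * a2 + (1 - l) * b2) in *.
  assert (Path : forall g, smooth2 V g -> forall t, 0 <= t <= 1 ->
    derivable_pt_lim (fun s => g (h s) (k s)) t
      (pd1 g (h t) (k t) * (a1 - b1) + pd2 g (h t) (k t) * (a2 - b2))).
  { intros g Hg t Ht.
    apply (derivable_pt_lim_comp2 V g (pd1 g, pd2 g)); cbn [fst snd];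
      auto using smooth2_dprim, smooth2_cont, smooth2_pd1, smooth2_pd2.
    - apply Hseg, Ht.
    - apply derivable_pt_lim_affine.
    - apply derivable_pt_lim_affine. }
  assert (S1 := smooth2_pd1 V u Su); assert (S2 := smooth2_pd2 V u Su).
  assert (C := strictly_convex_segment (fun s => u (h s) (k s))
    (fun s => pd1 u (h s) (k s) * (a1 - b1) + pd2 u (h s) (k s) * (a2 - b2))
    (fun s =>
       (pd1 (pd1 u) (h s) (k s) * (a1 - b1) + pd2 (pd1 u) (h s) (k s) * (a2 - b2)) * (a1 - b1)
       + (pd1 (pd2 u) (h s) (k s) * (a1 - b1) + pd2 (pd2 u) (h s) (k s) * (a2 - b2))
         * (a2 - b2)) (Path u Su)).
  assert (E1 : h 1 = a1 /\ k 1 = a2 /\ h 0 = b1 /\ k 0 = b2).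
  { unfold h, k; repeat split; ring. }
  destruct E1 as [E1 [E2 [E3 E4]]].
  cbv beta in C; rewrite E1, E2, E3, E4 in C; apply C; [| |exact Hl].
  - intros t Ht.
    apply (derivable_pt_lim_plus (fun s => pd1 u (h s) (k s) * (a1 - b1))
             (fun s => pd2 u (h s) (k s) * (a2 - b2))).
    + apply (derivable_pt_lim_ext_loc (fun s => (a1 - b1) * pd1 u (h s) (k s)) _ _ _ 1 Rlt_0_1);
        [intros; ring|].
      rewrite Rmult_comm; apply derivable_pt_lim_scal, Path; assumption.
    + apply (derivable_pt_lim_ext_loc (fun s => (a2 - b2) * pd2 u (h s) (k s)) _ _ _ 1 Rlt_0_1);
        [intros; ring|].
      rewrite Rmult_comm; apply derivable_pt_lim_scal, Path; assumption.
  - intros t Ht; assert (Hv := Hseg t Ht); fold (h t) (k t) in Hv.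
    specialize (HJ _ _ Hv); unfold Jdet in HJ.
    rewrite (smooth2_Schwarz V u _ _ HV Su Hv) in HJ |- *.
    assert (Q := quadratic_form_pos _ _ _ (a1 - b1) (a2 - b2) (H11 _ _ Hv) HJ).
    assert (0 < pd1 (pd1 u) (h t) (k t) * (a1 - b1) * (a1 - b1)
      + 2 * pd2 (pd1 u) (h t) (k t) * (a1 - b1) * (a2 - b2)
      + pd2 (pd2 u) (h t) (k t) * (a2 - b2) * (a2 - b2)).
    { apply Q; destruct Hne; [left | right]; lra. }
    lra.
Qed.

(** The value u_11 = 0 would make the determinant - u_12^2. If u_11 < 0, then u is strictly concave
    on a short horizontal segment, against convexity at its midpoint. *)
Lemma strictly_convex_pd11_pos V u x y : open2 V -> smooth2 V u ->
  strictly_convex_on V u -> V x y -> 0 < Jdet u x y -> 0 < pd1 (pd1 u) x y.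
Proof.
  intros HV Su Hc Hxy HJ.
  destruct (Rlt_le_dec 0 (pd1 (pd1 u) x y)) as [H|H]; [exact H|exfalso].
  assert (Hn : 0 < - pd1 (pd1 u) x y).
  { unfold Jdet in HJ; rewrite (smooth2_Schwarz V u x y HV Su Hxy) in HJ.
    destruct H as [H|H]; [lra|]; rewrite H in HJ; nra. }
  assert (S1 := smooth2_pd1 V u Su).
  assert (S11 := smooth2_pd1 V _ S1).
  destruct (cont2_pos_square V (fun a b => - pd1 (pd1 u) a b) x y HV)
    as [d [Hd [Ud Hneg]]]; auto.
  { apply smooth2_cont, smooth2_opp; assumption. }
  set (a := x + d / 2); set (b := x - d / 2); set (h := fun l => l * a + (1 - l) * b).
  assert (Hh : forall t, 0 <= t <= 1 -> square x y d (h t) y).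
  { intros t Ht; split; [|apply Rabs_0_lt, Hd].
    replace (h t - x) with (d * (t - / 2)) by (unfold h, a, b; field).
    apply Rabs_def1; nra. }
  assert (Path : forall g, smooth2 V g -> forall t, 0 <= t <= 1 ->
    derivable_pt_lim (fun s => g (h s) y) t (pd1 g (h t) y * d)).
  { intros g Hg t Ht.
    apply (derivable_pt_lim_comp h (fun s => g s y)).
    - eapply derivable_pt_lim_value; [apply derivable_pt_lim_affine|].
      unfold a, b; field.
    - apply (smooth2_dprim V g Hg), Ud, Hh, Ht. }
  assert (C := strictly_convex_segment (fun s => - u (h s) y)
    (fun s => - (pd1 u (h s) y * d)) (fun s => - (pd1 (pd1 u) (h s) y * d * d))).
  specialize (C (fun t Ht => derivable_pt_lim_opp _ _ _ (Path u Su t Ht))).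
  assert (C' : - u (h (/ 2)) y < / 2 * - u (h 1) y + (1 - / 2) * - u (h 0) y).
  { apply C; [| |lra].
    - intros t Ht.
      apply (derivable_pt_lim_opp (fun s => pd1 u (h s) y * d)).
      apply (derivable_pt_lim_ext_loc (fun s => d * pd1 u (h s) y) _ _ _ 1 Rlt_0_1);
        [intros; ring|].
      rewrite Rmult_comm; apply derivable_pt_lim_scal, Path; assumption.
    - intros t Ht; specialize (Hneg _ _ (Hh t Ht)); cbv beta in Hneg.
      assert (0 < - pd1 (pd1 u) (h t) y * (d * d)) by (apply Rmult_lt_0_compat; nra); lra. }
  assert (CC := Hc a y b y); cbn beta in CC.
  assert (K : forall l, l * y + (1 - l) * y = y) by (intros; ring).
  assert (B : u (h (/ 2)) y < / 2 * u a y + (1 - / 2) * u b y).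
  { rewrite <- (K (/ 2)) at 1; apply CC; [| |lra].
    - left; unfold a, b; lra.
    - intros l Hl; rewrite K; apply Ud, Hh, Hl. }
  replace (h 1) with a in C' by (unfold h; ring).
  replace (h 0) with b in C' by (unfold h; ring).
  lra.
Qed.

(** * The divergence form of equation (2) *)

(** With [flux2], the field psi''(J) cof(D^2 u) grad J, written before the substitution psi''(J) dJ
    = p(r) dr that [flux_eq] performs. *)
Definition flux1 (psi : R -> R) (u : R -> R -> R) (x y : R) : R :=
  der (der psi) (Jdet u x y)
  * (pd1 (Jdet u) x y * pd2 (pd2 u) x y - pd2 (Jdet u) x y * pd2 (pd1 u) x y).

Definition flux2 (psi : R -> R) (u : R -> R -> R) (x y : R) : R :=
  der (der psi) (Jdet u x y)
  * (pd2 (Jdet u) x y * pd1 (pd1 u) x y - pd1 (Jdet u) x y * pd1 (pd2 u) x y).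

Lemma pd1_sum_ext V g h F x y : open2 V -> smooth2 V g -> smooth2 V h ->
  (forall a b, V a b -> g a b + h a b = F a b) -> V x y ->
  pd1 g x y + pd1 h x y = pd1 F x y.
Proof.
  intros HV Sg Sh E Hxy; symmetry.
  exact (dprim_pd1 V F _ x y (dprim_ext V _ F _ HV E
    (dprim_plus V g h _ _ (smooth2_dprim V g Sg) (smooth2_dprim V h Sh))) Hxy).
Qed.

Lemma pd2_sum_ext V g h F x y : open2 V -> smooth2 V g -> smooth2 V h ->
  (forall a b, V a b -> g a b + h a b = F a b) -> V x y ->
  pd2 g x y + pd2 h x y = pd2 F x y.
Proof.
  intros HV Sg Sh E Hxy; symmetry.
  exact (dprim_pd2 V F _ x y (dprim_ext V _ F _ HV E
    (dprim_plus V g h _ _ (smooth2_dprim V g Sg) (smooth2_dprim V h Sh))) Hxy).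
Qed.

Section Divergence.

Variables (psi : R -> R) (V : R -> R -> Prop) (u : R -> R -> R).
Hypothesis psi_smooth : smooth1 (fun t => 0 < t) psi.
Hypothesis openV : open2 V.
Hypothesis smooth_u : smooth2 V u.
Hypothesis J_pos : forall x y, V x y -> 0 < Jdet u x y.

Lemma smooth2_der_psi_J :
  smooth2 V (fun x y => der psi (Jdet u x y)) /\
  smooth2 V (fun x y => der (der psi) (Jdet u x y)).
Proof.
  assert (SJ := smooth2_Jdet V u openV smooth_u).
  split; apply (smooth2_comp1 (fun t => 0 < t)); auto using smooth1_der.
Qed.

Lemma smooth2_flux : smooth2 V (flux1 psi u) /\ smooth2 V (flux2 psi u).
Proof.
  assert (SJ := smooth2_Jdet V u openV smooth_u).
  destruct smooth2_der_psi_J as [_ S2].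
  split; apply smooth2_mult; auto; apply smooth2_minus; auto; apply smooth2_mult;
    auto using smooth2_pd1, smooth2_pd2.
Qed.

(** The factor J cancels on V and leaves psi'(J) h, to be used with h a signed second derivative of
    u. *)
Lemma weighted_dprim h : smooth2 V h ->
  dprim V (fun x y => Jdet u x y * der psi (Jdet u x y) * (h x y / Jdet u x y))
    (fun x y => der (der psi) (Jdet u x y) * pd1 (Jdet u) x y * h x y
                + der psi (Jdet u x y) * pd1 h x y,
     fun x y => der (der psi) (Jdet u x y) * pd2 (Jdet u) x y * h x y
                + der psi (Jdet u x y) * pd2 h x y).
Proof.
  intros Sh.
  assert (SJ := smooth2_Jdet V u openV smooth_u).
  apply (dprim_ext V (fun x y => der psi (Jdet u x y) * h x y)); [exact openV | |].
  - intros x y Hxy; specialize (J_pos x y Hxy); field; lra.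
  - apply (dprim_mult V (fun x y => der psi (Jdet u x y)) h
      (fun x y => der (der psi) (Jdet u x y) * pd1 (Jdet u) x y,
       fun x y => der (der psi) (Jdet u x y) * pd2 (Jdet u) x y) (pd1 h, pd2 h));
      [|apply smooth2_dprim, Sh].
    apply (dprim_comp1 V (der psi) (der (der psi)) (Jdet u) (pd1 (Jdet u), pd2 (Jdet u)));
      [apply smooth2_dprim, SJ|].
    intros x y Hxy; apply (smooth1_derivable (fun t => 0 < t)); auto using smooth1_der.
Qed.

(* The rows of the cofactor matrix of the Hessian are divergence free, so only the
   derivatives of psi'(J) survive in the inner divergence. *)
Lemma eq2_divergence :
  eq2 psi V u <->
  forall x y, V x y -> pd1 (flux1 psi u) x y + pd2 (flux2 psi u) x y = 0.
Proof.
  assert (SJ := smooth2_Jdet V u openV smooth_u).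
  destruct smooth2_der_psi_J as [P1 P2].
  set (J := Jdet u) in *.
  assert (S1 := smooth2_pd1 V u smooth_u); assert (S2 := smooth2_pd2 V u smooth_u).
  assert (S11 := smooth2_pd1 V _ S1); assert (S12 := smooth2_pd2 V _ S1).
  assert (S21 := smooth2_pd1 V _ S2); assert (S22 := smooth2_pd2 V _ S2).
  assert (N12 := smooth2_opp V _ openV S12); assert (N21 := smooth2_opp V _ openV S21).
  set (A1 := fun h x y => der (der psi) (J x y) * pd1 J x y * h x y
                          + der psi (J x y) * pd1 h x y).
  set (A2 := fun h x y => der (der psi) (J x y) * pd2 J x y * h x y
                          + der psi (J x y) * pd2 h x y).
  set (W := fun h x y => J x y * der psi (J x y) * (h x y / J x y)).
  assert (DW : forall h, smooth2 V h -> dprim V (W h) (A1 h, A2 h)) by exact weighted_dprim.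
  assert (SA1 : forall h, smooth2 V h -> smooth2 V (A1 h)).
  { intros h Sh; apply smooth2_plus; auto; repeat apply smooth2_mult;
      auto using smooth2_pd1. }
  assert (SA2 : forall h, smooth2 V h -> smooth2 V (A2 h)).
  { intros h Sh; apply smooth2_plus; auto; repeat apply smooth2_mult;
      auto using smooth2_pd2. }
  assert (E1 : forall h x y, smooth2 V h -> V x y -> A1 h x y = pd1 (W h) x y).
  { intros h x y Sh Hxy; symmetry; apply (dprim_pd1 V _ _ x y (DW h Sh) Hxy). }
  assert (E2 : forall h x y, smooth2 V h -> V x y -> A2 h x y = pd2 (W h) x y).
  { intros h x y Sh Hxy; symmetry; apply (dprim_pd2 V _ _ x y (DW h Sh) Hxy). }
  assert (F1 : forall x y, V x y ->
    pd1 (pd1 (W (pd2 (pd2 u)))) x y + pd1 (pd2 (W (fun x y => - pd2 (pd1 u) x y))) x y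
    = pd1 (flux1 psi u) x y).
  { intros x y Hxy.
    rewrite (pd1_ext V (A1 (pd2 (pd2 u))) (pd1 (W (pd2 (pd2 u))))),
      (pd1_ext V (A2 (fun x y => - pd2 (pd1 u) x y))
        (pd2 (W (fun x y => - pd2 (pd1 u) x y)))); auto using smooth2_has_pd.
    apply (pd1_sum_ext V); auto.
    intros a b Hab; unfold A1, A2, flux1; fold J.
    rewrite (dprim_pd2 V _ _ a b (dprim_opp V _ _ (smooth2_dprim V _ S12)) Hab).
    cbn [fst snd].
    (* Both third derivatives are brought to the form [pd2 (pd2 (pd1 u))], after which the terms
       with psi'(J) cancel. *)
    rewrite (smooth2_Schwarz V (pd2 u) a b openV S2 Hab).
    rewrite (pd2_ext V (pd2 (pd1 u)) (pd1 (pd2 u)) a b openV); auto using smooth2_has_pd;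
      [ring|].
    intros c e Hce; symmetry; apply (smooth2_Schwarz V u c e openV smooth_u Hce). }
  assert (F2 : forall x y, V x y ->
    pd2 (pd1 (W (fun x y => - pd1 (pd2 u) x y))) x y + pd2 (pd2 (W (pd1 (pd1 u)))) x y
    = pd2 (flux2 psi u) x y).
  { intros x y Hxy.
    rewrite (pd2_ext V (A1 (fun x y => - pd1 (pd2 u) x y))
        (pd1 (W (fun x y => - pd1 (pd2 u) x y)))),
      (pd2_ext V (A2 (pd1 (pd1 u))) (pd2 (W (pd1 (pd1 u))))); auto using smooth2_has_pd.
    apply (pd2_sum_ext V); auto.
    intros a b Hab; unfold A1, A2, flux2; fold J.
    rewrite (dprim_pd1 V _ _ a b (dprim_opp V _ _ (smooth2_dprim V _ S21)) Hab).
    cbn [fst snd].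
    rewrite <- (smooth2_Schwarz V (pd1 u) a b openV S1 Hab).
    rewrite (pd1_ext V (pd2 (pd1 u)) (pd1 (pd2 u)) a b openV); auto using smooth2_has_pd;
      [ring|].
    intros c e Hce; symmetry; apply (smooth2_Schwarz V u c e openV smooth_u Hce). }
  unfold eq2; fold J; cbv zeta.
  split; intros H x y Hxy.
  - rewrite <- (H x y Hxy), <- F1, <- F2 by exact Hxy; unfold W; ring.
  - rewrite <- (H x y Hxy), <- F1, <- F2 by exact Hxy; unfold W; ring.
Qed.

End Divergence.

(** * Potentials and solutions *)

Section Correspondence.

Variables (psi f p : R -> R).
Hypothesis psi_smooth : smooth1 (fun t => 0 < t) psi.
Hypothesis psi_strict : forall t, 0 < t -> 0 < der (der psi) t.
Hypothesis f_deriv : forall t, 0 < t -> derivable_pt_lim f t (sqrt t * der (der psi) t).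
Hypothesis p_def : forall t, 0 < t -> p (f t) = / sqrt t.

Let Ival := fun r => exists t, 0 < t /\ f t = r.

Lemma p_f_pos t : 0 < t -> 0 < p (f t).
Proof. intros Ht; rewrite p_def by exact Ht; apply Rinv_0_lt_compat, sqrt_lt_R0, Ht. Qed.

(** * The functions f and p *)

Lemma p_f_sqr t : 0 < t -> p (f t) * p (f t) * t = 1.
Proof.
  intros Ht; rewrite p_def by exact Ht; pose proof (sqrt_lt_R0 t Ht).
  rewrite <- (sqrt_sqrt t) at 3 by lra; field; lra.
Qed.

Lemma f_comp_dprim V g : smooth2 V g -> (forall x y, V x y -> 0 < g x y) ->
  dprim V (fun x y => f (g x y))
    (fun x y => sqrt (g x y) * der (der psi) (g x y) * pd1 g x y,
     fun x y => sqrt (g x y) * der (der psi) (g x y) * pd2 g x y).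
Proof.
  intros Sg Hg.
  apply (dprim_comp1 V f (fun t => sqrt t * der (der psi) t) g (pd1 g, pd2 g));
    auto using smooth2_dprim.
Qed.

(** What is known of f is its derivative sqrt(t) psi''(t), whose composite with g is smooth; hence
    the partial derivatives of f(g) are smooth, and so is f(g). *)
Lemma f_comp_smooth2 V g : open2 V -> smooth2 V g -> (forall x y, V x y -> 0 < g x y) ->
  smooth2 V (fun x y => f (g x y)).
Proof.
  intros HV Sg Hg.
  assert (S : smooth2 V (fun x y => sqrt (g x y) * der (der psi) (g x y))).
  { apply smooth2_mult; auto using smooth2_sqrt.
    apply (smooth2_comp1 (fun t => 0 < t)); auto using smooth1_der. }
  apply (dprim_smooth2 V _ _ HV (f_comp_dprim V g Sg Hg)); cbn [fst snd];
    apply smooth2_mult; auto using smooth2_pd1, smooth2_pd2.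
Qed.

(* Near [r = f t] the inverse of [f] is the second component of the local inverse of
   the plane map [(s, t) |-> (s, f t)]. *)
Lemma p_smooth2 Om : (forall H r, Om H r -> Ival r) -> smooth2 Om (fun _ r => p r).
Proof.
  intros HI k; apply Ck2_local; intros H r Hr.
  destruct (HI H r Hr) as [t [Ht <-]].
  set (U := fun _ s : R => 0 < s).
  assert (HU : open2 U).
  { intros x y Hy; exists y; split; [exact Hy|].
    intros x' y' _ B; apply Rabs_def2 in B; unfold U; lra. }
  assert (Sf : smooth2 U (fun _ s => f s)).
  { apply (f_comp_smooth2 U (fun _ s => s) HU); [intros n; apply Ck2_snd, HU | auto]. }
  assert (Df := f_comp_dprim U (fun _ s => s) (fun n => Ck2_snd U n HU) (fun x y H => H)).
  destruct (inverse_function_theorem U (fun s _ => s) (fun _ s => f s) H t HU Ht)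
    as [A [B [g1 [g2 [HAU [HAt [_ [HB [_ [_ [_ [S2 [HAB HBA]]]]]]]]]]]]].
  - intros n; apply Ck2_fst, HU.
  - exact Sf.
  (* The Jacobian of the plane map is f'(t), which is positive. *)
  - unfold Jac.
    rewrite (dprim_pd1 U _ _ H t (dprim_fst U) Ht), (dprim_pd2 U _ _ H t (dprim_fst U) Ht).
    rewrite (dprim_pd2 U _ _ H t Df Ht); cbn [fst snd].
    rewrite (dprim_pd2 U _ _ H t (dprim_snd U) Ht); cbn [fst snd].
    pose proof (sqrt_lt_R0 t Ht); pose proof (psi_strict t Ht).
    assert (0 < sqrt t * der (der psi) t) by (apply Rmult_lt_0_compat; assumption); lra.
  - exists B; split; [apply (HAB H t HAt)|].
    assert (Hpos : forall x y, B x y -> 0 < g2 x y).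
    { intros x y Hxy; apply (HAU (g1 x y)), HBA, Hxy. }
    apply (Ck2_ext B k (fun x y => / sqrt (g2 x y))); [exact HB | |].
    + intros x y Hxy; rewrite <- (p_def _ (Hpos x y Hxy)).
      f_equal; apply HBA, Hxy.
    + apply smooth2_inv; auto using smooth2_sqrt.
      intros x y Hxy; pose proof (sqrt_lt_R0 _ (Hpos x y Hxy)); lra.
Qed.

(** * The three forms and equation (3) *)

Lemma p_dprim Om : smooth2 Om (fun _ r => p r) ->
  dprim Om (fun _ r => p r) (fun _ _ => 0, pd2 (fun _ r => p r)).
Proof.
  intros Sp x y Hxy; split; [apply derivable_pt_lim_const|].
  apply (smooth2_dprim Om _ Sp x y Hxy).
Qed.

Lemma pd1_p_mult Om g H r : smooth2 Om (fun _ r => p r) -> smooth2 Om g -> Om H r ->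
  pd1 (fun H r => p r * g H r) H r = p r * pd1 g H r.
Proof.
  intros Sp Sg HO.
  rewrite (dprim_pd1 Om _ _ H r
    (dprim_mult Om (fun _ r => p r) g _ _ (p_dprim Om Sp) (smooth2_dprim Om g Sg)) HO).
  cbn [fst snd]; ring.
Qed.

Lemma eps1_smooth2 Om xi : open2 Om -> smooth2 Om (fun _ r => p r) -> smooth2 Om xi ->
  smooth2 Om (fst (eps1f p xi)) /\ smooth2 Om (snd (eps1f p xi)).
Proof.
  intros HO Sp Sx; split; cbn [eps1f fst snd].
  - apply (smooth2_mult Om (fun _ r => p r)); auto using smooth2_pd2.
  - apply smooth2_opp; auto.
    apply (smooth2_mult Om (fun _ r => p r)); auto using smooth2_pd1.
Qed.

Lemma eps2_smooth2 Om xi : open2 Om -> smooth2 Om (fun _ r => p r) -> smooth2 Om xi ->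
  smooth2 Om (fst (eps2f p xi)) /\ smooth2 Om (snd (eps2f p xi)).
Proof.
  intros HO Sp Sx; split; cbn [eps2f fst snd].
  - apply smooth2_opp; auto.
    apply (smooth2_mult Om (fun _ r => p r)); auto using smooth2_pd2.
  - apply (smooth2_mult Om (fun _ r => p r)); auto using smooth2_pd1.
Qed.

Lemma eps_smooth2 Om xi1 xi2 : open2 Om -> smooth2 Om (fun _ r => p r) ->
  smooth2 Om xi1 -> smooth2 Om xi2 ->
  smooth2 Om (fst (epsf p xi1 xi2)) /\ smooth2 Om (snd (epsf p xi1 xi2)).
Proof.
  intros HO Sp S1 S2.
  destruct (eps1_smooth2 Om xi2 HO Sp S2), (eps2_smooth2 Om xi1 HO Sp S1).
  split; cbn [epsf fst snd]; apply smooth2_plus; auto; apply smooth2_mult; auto.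
Qed.

(** Closedness reads (p xi_r)_r = - p xi_HH, which is (3) multiplied by p. *)
Lemma eps1_closed Om xi : open2 Om -> smooth2 Om (fun _ r => p r) ->
  (forall H r, Om H r -> 0 < p r) -> eq3 p Om xi -> closed_on Om (eps1f p xi).
Proof.
  intros HO Sp Hp [Sx E].
  destruct (eps1_smooth2 Om xi HO Sp Sx) as [T1 T2].
  split; [apply smooth2_has_pd, T1 | split; [apply smooth2_has_pd, T2|]].
  intros H r Hr; specialize (E H r Hr); specialize (Hp H r Hr).
  cbn [eps1f fst snd].
  assert (S1 := smooth2_pd1 Om xi Sx).
  rewrite (dprim_pd1 Om _ _ H r (dprim_opp Om _ _ (smooth2_dprim Om _
    (smooth2_mult Om (fun _ r => p r) _ HO Sp S1))) Hr); cbn [fst snd].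
  rewrite (pd1_p_mult Om _ H r Sp S1 Hr).
  set (X := pd2 _ H r) in *.
  replace X with (p r * (/ p r * X)) by (field; lra).
  replace (/ p r * X) with (- pd1 (pd1 xi) H r) by lra; ring.
Qed.

(** For one and the same xi, [eps2f p xi] is the opposite of [eps1f p xi], so closedness of the
    second form reduces to that of the first. *)
Lemma closed_opp Om (w v : form) : open2 Om -> closed_on Om w ->
  (forall H r, fst v H r = - fst w H r /\ snd v H r = - snd w H r) -> closed_on Om v.
Proof.
  intros HO [P1 [P2 E]] Hv.
  assert (D1 := dprim_ext Om _ (fst v) _ HO (fun x y _ => eq_sym (proj1 (Hv x y)))
                  (dprim_opp Om _ _ (has_pd_dprim Om _ P1))).
  assert (D2 := dprim_ext Om _ (snd v) _ HO (fun x y _ => eq_sym (proj2 (Hv x y)))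
                  (dprim_opp Om _ _ (has_pd_dprim Om _ P2))).
  split; [apply (dprim_has_pd Om _ _ D1) | split; [apply (dprim_has_pd Om _ _ D2)|]].
  intros H r Hr.
  rewrite (dprim_pd2 Om _ _ H r D1 Hr), (dprim_pd1 Om _ _ H r D2 Hr); cbn [fst snd].
  rewrite E by exact Hr; reflexivity.
Qed.

Lemma eps2_closed Om xi : open2 Om -> smooth2 Om (fun _ r => p r) ->
  (forall H r, Om H r -> 0 < p r) -> eq3 p Om xi -> closed_on Om (eps2f p xi).
Proof.
  intros HO Sp Hp E; apply (closed_opp Om (eps1f p xi) _ HO);
    [apply eps1_closed; assumption|].
  intros H r; cbn [eps1f eps2f fst snd]; split; ring.
Qed.

(** Since eps_1 and eps_2 are closed, d eps is the sum of the wedge products of d xi_i with eps_i.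
    With eps_1 = - p star(d xi_2) and eps_2 = p star(d xi_1), the two terms cancel by the symmetry
    of the inner product. *)
Lemma eps_closed Om xi1 xi2 : open2 Om -> smooth2 Om (fun _ r => p r) ->
  (forall H r, Om H r -> 0 < p r) -> eq3 p Om xi1 -> eq3 p Om xi2 ->
  closed_on Om (epsf p xi1 xi2).
Proof.
  intros HO Sp Hp E1 E2.
  destruct (eps1_closed Om xi2 HO Sp Hp E2) as [P1 [P2 C1]].
  destruct (eps2_closed Om xi1 HO Sp Hp E1) as [Q1 [Q2 C2]].
  destruct E1 as [S1 _], E2 as [S2 _].
  assert (D1 := smooth2_dprim Om xi1 S1); assert (D2 := smooth2_dprim Om xi2 S2).
  assert (F1 := dprim_plus Om _ _ _ _
    (dprim_mult Om _ _ _ _ D1 (has_pd_dprim Om _ P1))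
    (dprim_mult Om _ _ _ _ D2 (has_pd_dprim Om _ Q1))).
  assert (F2 := dprim_plus Om _ _ _ _
    (dprim_mult Om _ _ _ _ D1 (has_pd_dprim Om _ P2))
    (dprim_mult Om _ _ _ _ D2 (has_pd_dprim Om _ Q2))).
  split; [apply (dprim_has_pd Om _ _ F1) | split; [apply (dprim_has_pd Om _ _ F2)|]].
  intros H r Hr; unfold epsf; cbn [fst snd].
  rewrite (dprim_pd2 Om _ _ H r F1 Hr), (dprim_pd1 Om _ _ H r F2 Hr); cbn [fst snd].
  rewrite C1, C2 by exact Hr.
  cbn [eps1f eps2f fst snd]; ring.
Qed.

(** Converse of [eps1_closed]: the symmetry of the second derivatives of the potential y is (3)
    multiplied by p. *)
Lemma dprim_eps1_eq3 Om xi y : open2 Om -> smooth2 Om (fun _ r => p r) ->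
  (forall H r, Om H r -> 0 < p r) -> smooth2 Om xi -> smooth2 Om y ->
  dprim Om y (eps1f p xi) -> eq3 p Om xi.
Proof.
  intros HO Sp Hp Sx Sy D; split; [exact Sx|]; intros H r Hr.
  specialize (Hp H r Hr).
  assert (S1 := smooth2_pd1 Om xi Sx).
  rewrite (pd2_ext Om (pd1 y) (fun H' r' => p r' * pd2 xi H' r') H r HO); auto;
    [|intros a b Hab; apply (dprim_pd1 Om y _ a b D Hab)
     |apply smooth2_has_pd, smooth2_pd1, Sy].
  rewrite <- (smooth2_Schwarz Om y H r HO Sy Hr).
  rewrite (pd1_ext Om (fun H r => - (p r * pd1 xi H r)) (pd2 y) H r HO); auto.
  - rewrite (dprim_pd1 Om _ _ H r (dprim_opp Om _ _ (smooth2_dprim Om _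
      (smooth2_mult Om (fun _ r => p r) _ HO Sp S1))) Hr); cbn [fst snd].
    rewrite (pd1_p_mult Om _ H r Sp S1 Hr); field; lra.
  - intros a b Hab; symmetry; apply (dprim_pd2 Om y _ a b D Hab).
  - apply smooth2_has_pd, (eps1_smooth2 Om xi HO Sp Sx).
Qed.

Lemma dprim_eps2_eq3 Om xi y : open2 Om -> smooth2 Om (fun _ r => p r) ->
  (forall H r, Om H r -> 0 < p r) -> smooth2 Om xi -> smooth2 Om y ->
  dprim Om y (eps2f p xi) -> eq3 p Om xi.
Proof.
  intros HO Sp Hp Sx Sy D.
  apply (dprim_eps1_eq3 Om xi (fun H r => - y H r)); auto using smooth2_opp.
  apply (dprim_value Om _ _ _ (dprim_opp Om y _ D)).
  intros H r _; cbn [eps1f eps2f fst snd]; split; ring.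
Qed.

(** * Passage between potentials and solutions *)

Lemma flux_eq V u rc a b : open2 V -> smooth2 V u ->
  (forall x y, V x y -> 0 < Jdet u x y) -> rc = (fun a b => f (Jdet u a b)) -> V a b ->
  flux1 psi u a b = p (rc a b) * (pd1 rc a b * pd2 (pd2 u) a b - pd2 rc a b * pd2 (pd1 u) a b) /\
  flux2 psi u a b = p (rc a b) * (pd2 rc a b * pd1 (pd1 u) a b - pd1 rc a b * pd2 (pd1 u) a b).
Proof.
  intros HV Su HJ -> Hab.
  assert (D := f_comp_dprim V (Jdet u) (smooth2_Jdet V u HV Su) HJ).
  specialize (HJ a b Hab); pose proof (sqrt_lt_R0 _ HJ).
  unfold flux1, flux2; rewrite (dprim_pd1 V _ _ a b D Hab), (dprim_pd2 V _ _ a b D Hab).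
  rewrite (p_def _ HJ), (smooth2_Schwarz V u a b HV Su Hab); cbn [fst snd].
  split; field; lra.
Qed.

Lemma eps_wedge xi1 xi2 H r :
  fst (eps1f p xi2) H r * snd (eps2f p xi1) H r
  - snd (eps1f p xi2) H r * fst (eps2f p xi1) H r = p r * p r * Jac xi1 xi2 H r.
Proof. unfold Jac; cbn [eps1f eps2f fst snd]; ring. Qed.

Lemma solution_from_potentials Om H0 r0 xi1 xi2 u x1 x2 :
  open2 Om -> Om H0 r0 -> (forall H r, Om H r -> Ival r) ->
  smooth2 Om xi1 -> smooth2 Om xi2 -> (forall H r, Om H r -> 0 < Jac xi1 xi2 H r) ->
  dprim Om u (epsf p xi1 xi2) -> dprim Om x1 (eps1f p xi2) -> dprim Om x2 (eps2f p xi1) ->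
  exists (Om2 V : R -> R -> Prop) (y1 y2 : R -> R -> R),
    subset2 Om2 Om /\ Om2 H0 r0 /\ diffeo Om2 V x1 x2 y1 y2 /\
    let U := fun a b => u (y1 a b) (y2 a b) in
    sol2 psi V U /\
    (forall a b, V a b ->
       pd1 U a b = xi1 (y1 a b) (y2 a b) /\ pd2 U a b = xi2 (y1 a b) (y2 a b)) /\
    (forall a b, V a b -> ordinary U a b).
Proof.
  intros HO HOm HI S1 S2 HJ Du D1 D2.
  assert (Sp := p_smooth2 Om HI).
  assert (Hp : forall H r, Om H r -> 0 < p r).
  { intros H r Hr; destruct (HI H r Hr) as [t [Ht <-]]; apply p_f_pos, Ht. }
  destruct (eps1_smooth2 Om xi2 HO Sp S2) as [T1 T1'].
  destruct (eps2_smooth2 Om xi1 HO Sp S1) as [T2 T2'].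
  destruct (eps_smooth2 Om xi1 xi2 HO Sp S1 S2) as [T3 T3'].
  assert (Sx1 := dprim_smooth2 Om x1 _ HO D1 T1 T1').
  assert (Sx2 := dprim_smooth2 Om x2 _ HO D2 T2 T2').
  assert (Su := dprim_smooth2 Om u _ HO Du T3 T3').
  assert (EJ : forall H r, Om H r -> Jac x1 x2 H r = p r * p r * Jac xi1 xi2 H r).
  { intros H r Hr; rewrite <- eps_wedge; unfold Jac.
    rewrite (dprim_pd1 Om _ _ H r D1 Hr), (dprim_pd2 Om _ _ H r D1 Hr).
    rewrite (dprim_pd1 Om _ _ H r D2 Hr), (dprim_pd2 Om _ _ H r D2 Hr); reflexivity. }
  destruct (inverse_function_theorem Om x1 x2 H0 r0 HO HOm Sx1 Sx2)
    as [Om2 [V [y1 [y2 [Hsub [HOm2 Hdiff]]]]]].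
  { rewrite EJ by exact HOm; pose proof (Hp _ _ HOm); pose proof (HJ _ _ HOm).
    apply Rgt_not_eq; repeat apply Rmult_lt_0_compat; assumption. }
  exists Om2, V, y1, y2; split; [exact Hsub | split; [exact HOm2 | split; [exact Hdiff|]]].
  intros U.
  destruct (Hdiff) as [HO2 [HV [_ [_ [Sy1 [Sy2 [_ HVO]]]]]]].
  assert (Hy : forall a b, V a b -> Om (y1 a b) (y2 a b)).
  { intros a b Hab; apply Hsub, HVO, Hab. }
  (* Let M be the Jacobian matrix of (xi1, xi2) in (H, r) and d = p det M. Inverting dx_i = eps_i
     shows that the Jacobian matrix of (y1, y2) is the transpose of M divided by d. *)
  assert (Inv : forall a b, V a b ->
    let H := y1 a b in let r := y2 a b in let d := p r * Jac xi1 xi2 H r in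
    pd1 y1 a b = pd1 xi1 H r / d /\ pd2 y1 a b = pd1 xi2 H r / d /\
    pd1 y2 a b = pd2 xi1 H r / d /\ pd2 y2 a b = pd2 xi2 H r / d).
  { intros a b Hab H r d.
    destruct (HVO a b Hab) as [HOab [Ea Eb]].
    assert (P := diffeo_inverse_pd Om2 V x1 x2 y1 y2 _ _ Hdiff HOab).
    cbv zeta in P; rewrite Ea, Eb in P; destruct P as [_ [P1 [P2 [P3 P4]]]].
    rewrite P1, P2, P3, P4; fold H r.
    assert (Hr : Om H r) by (apply Hy, Hab).
    rewrite (dprim_pd1 Om _ _ H r D1 Hr), (dprim_pd2 Om _ _ H r D1 Hr).
    rewrite (dprim_pd1 Om _ _ H r D2 Hr), (dprim_pd2 Om _ _ H r D2 Hr).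
    rewrite (EJ H r Hr); cbn [eps1f eps2f fst snd]; unfold d.
    specialize (Hp H r Hr); specialize (HJ H r Hr); repeat split; field; lra. }
  assert (SU : smooth2 V U) by (apply (smooth2_comp2 V Om u); assumption).
  assert (DU : dprim V U (fun a b => xi1 (y1 a b) (y2 a b), fun a b => xi2 (y1 a b) (y2 a b))).
  { apply (dprim_value V U _ _ (smooth2_comp2_dprim V Om u y1 y2 HV HO Su Sy1 Sy2 Hy)).
    intros a b Hab; cbn [fst snd].
    destruct (Inv a b Hab) as [P1 [P2 [P3 P4]]]; specialize (Hy a b Hab).
    rewrite P1, P2, P3, P4.
    rewrite (dprim_pd1 Om _ _ _ _ Du Hy), (dprim_pd2 Om _ _ _ _ Du Hy).
    cbn [epsf eps1f eps2f fst snd].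
    specialize (Hp _ _ Hy); specialize (HJ _ _ Hy); unfold Jac in *.
    split; field; split; lra. }
  assert (Grad : forall a b, V a b ->
    pd1 U a b = xi1 (y1 a b) (y2 a b) /\ pd2 U a b = xi2 (y1 a b) (y2 a b)).
  { intros a b Hab; split;
      [apply (dprim_pd1 V U _ a b DU Hab) | apply (dprim_pd2 V U _ a b DU Hab)]. }
  assert (DD1 := dprim_ext V _ (pd1 U) _ HV (fun a b H => eq_sym (proj1 (Grad a b H)))
    (smooth2_comp2_dprim V Om xi1 y1 y2 HV HO S1 Sy1 Sy2 Hy)).
  assert (DD2 := dprim_ext V _ (pd2 U) _ HV (fun a b H => eq_sym (proj2 (Grad a b H)))
    (smooth2_comp2_dprim V Om xi2 y1 y2 HV HO S2 Sy1 Sy2 Hy)).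
  (* By the chain rule the Hessian of U is M M^T / d: symmetric, positive definite, with determinant
     1 / p^2. *)
  assert (Hess : forall a b, V a b ->
    let H := y1 a b in let r := y2 a b in let d := p r * Jac xi1 xi2 H r in
    pd1 (pd1 U) a b = (pd1 xi1 H r * pd1 xi1 H r + pd2 xi1 H r * pd2 xi1 H r) / d /\
    pd2 (pd1 U) a b = (pd1 xi1 H r * pd1 xi2 H r + pd2 xi1 H r * pd2 xi2 H r) / d /\
    pd1 (pd2 U) a b = (pd1 xi1 H r * pd1 xi2 H r + pd2 xi1 H r * pd2 xi2 H r) / d /\
    pd2 (pd2 U) a b = (pd1 xi2 H r * pd1 xi2 H r + pd2 xi2 H r * pd2 xi2 H r) / d).
  { intros a b Hab H r d.
    destruct (Inv a b Hab) as [P1 [P2 [P3 P4]]].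
    rewrite (dprim_pd1 V _ _ a b DD1 Hab), (dprim_pd2 V _ _ a b DD1 Hab).
    rewrite (dprim_pd1 V _ _ a b DD2 Hab), (dprim_pd2 V _ _ a b DD2 Hab); cbn [fst snd].
    rewrite P1, P2, P3, P4; fold H r; fold d.
    assert (Hd : 0 < d) by (apply Rmult_lt_0_compat; [apply (Hp H) | apply HJ]; apply Hy, Hab).
    repeat split; field; lra. }
  assert (EdetU : forall a b, V a b -> Jdet U a b = / (p (y2 a b) * p (y2 a b))).
  { intros a b Hab; destruct (Hess a b Hab) as [P1 [P2 [P3 P4]]].
    unfold Jdet; rewrite P1, P2, P3, P4.
    specialize (Hy a b Hab); specialize (Hp _ _ Hy); specialize (HJ _ _ Hy); unfold Jac in *.
    field; split; lra. }
  assert (JU : forall a b, V a b -> 0 < Jdet U a b).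
  { intros a b Hab; rewrite (EdetU a b Hab).
    pose proof (Hp _ _ (Hy a b Hab)); apply Rinv_0_lt_compat, Rmult_lt_0_compat; assumption. }
  (* As r lies in the range of f, r = f(t) for some t > 0, and J = 1 / p(r)^2 = t. *)
  assert (rU : forall a b, V a b -> f (Jdet U a b) = y2 a b).
  { intros a b Hab; rewrite (EdetU a b Hab).
    destruct (HI _ _ (Hy a b Hab)) as [t [Ht Et]]; rewrite <- Et.
    f_equal; pose proof (p_f_sqr t Ht); pose proof (p_f_pos t Ht).
    apply (Rmult_eq_reg_l (p (f t) * p (f t))); [rewrite Rinv_r; nra | nra]. }
  assert (SJ := smooth2_Jdet V U HV SU).
  assert (Dr := dprim_ext V _ y2 _ HV rU (f_comp_dprim V (Jdet U) SJ JU)).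
  split; [split; [exact HV | split; [exact SU | split; [|split; [exact JU|]]]]
         | split; [exact Grad|]].
  - apply strictly_convex_of_hessian; auto.
    intros a b Hab; destruct (Hess a b Hab) as [P1 _]; rewrite P1.
    specialize (Hy a b Hab); specialize (Hp _ _ Hy); specialize (HJ _ _ Hy).
    apply Rdiv_lt_0_compat; [|apply Rmult_lt_0_compat; assumption].
    unfold Jac in HJ.
    (* The numerator of u_11 is the squared length of the first row of M, which cannot vanish
       because det M > 0. *)
    set (s := pd1 xi1 _ _) in *; set (t := pd2 xi1 _ _) in *.
    destruct (Req_dec s 0) as [Es|Es]; [|pose proof (Rsqr_pos_lt s Es); unfold Rsqr in *; nra].
    destruct (Req_dec t 0) as [Et|Et]; [|pose proof (Rsqr_pos_lt t Et); unfold Rsqr in *; nra].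
    rewrite Es, Et in HJ; lra.
  - apply (eq2_divergence psi V U psi_smooth HV SU JU).
    assert (Fl : forall a b, V a b ->
      flux1 psi U a b = - pd2 y1 a b /\ flux2 psi U a b = pd1 y1 a b).
    { intros a b Hab.
      destruct (flux_eq V U _ a b HV SU JU eq_refl Hab) as [F1 F2].
      cbv beta in F1, F2; rewrite F1, F2, (rU a b Hab).
      assert (E1 : pd1 (fun a b => f (Jdet U a b)) a b = pd1 y2 a b).
      { symmetry; apply (pd1_ext V); auto.
        apply (smooth2_has_pd V), f_comp_smooth2; auto. }
      assert (E2 : pd2 (fun a b => f (Jdet U a b)) a b = pd2 y2 a b).
      { symmetry; apply (pd2_ext V); auto.
        apply (smooth2_has_pd V), f_comp_smooth2; auto. }
      rewrite E1, E2.
      destruct (Inv a b Hab) as [P1 [P2 [P3 P4]]], (Hess a b Hab) as [Q1 [Q2 [Q3 Q4]]].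
      rewrite P1, P2, P3, P4, Q1, Q2, Q4.
      specialize (Hy a b Hab); specialize (Hp _ _ Hy); specialize (HJ _ _ Hy); unfold Jac in *.
      split; field; split; lra. }
    intros a b Hab.
    rewrite (pd1_ext V (fun a b => - pd2 y1 a b) (flux1 psi U) a b HV); auto;
      [|intros c e Hce; symmetry; apply (Fl c e Hce)
       |apply smooth2_has_pd, smooth2_opp, smooth2_pd2; assumption].
    rewrite (pd2_ext V (pd1 y1) (flux2 psi U) a b HV); auto;
      [|intros c e Hce; symmetry; apply (Fl c e Hce)
       |apply smooth2_has_pd, smooth2_pd1; assumption].
    rewrite (dprim_pd1 V _ _ a b (dprim_opp V _ _ (smooth2_dprim V _ (smooth2_pd2 V y1 Sy1)))
               Hab); cbn [fst snd].
    rewrite (smooth2_Schwarz V y1 a b HV Sy1 Hab); ring.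
  - intros a b Hab.
    destruct (Req_dec (pd1 (Jdet U) a b) 0) as [E1|E1]; [|left; exact E1].
    destruct (Req_dec (pd2 (Jdet U) a b) 0) as [E2|E2]; [|right; exact E2].
    (* If grad J vanished, so would grad r, and the Jacobian of the coordinates (H, r) with it. *)
    exfalso.
    assert (Z1 := dprim_pd1 V y2 _ a b Dr Hab); assert (Z2 := dprim_pd2 V y2 _ a b Dr Hab).
    cbn [fst snd] in Z1, Z2; rewrite E1, Rmult_0_r in Z1; rewrite E2, Rmult_0_r in Z2.
    destruct (diffeo_inverse_pd V Om2 y1 y2 x1 x2 a b (diffeo_sym _ _ _ _ _ _ Hdiff) Hab)
      as [HD _].
    apply HD; unfold Jac; rewrite Z1, Z2; ring.
Qed.

Lemma potentials_from_solution V u a0 b0 :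
  sol2 psi V u -> V a0 b0 -> ordinary u a0 b0 ->
  let rc := fun a b => f (Jdet u a b) in
  exists (W Om : R -> R -> Prop) (Hc y1 y2 : R -> R -> R),
    subset2 W V /\ W a0 b0 /\ (forall H r, Om H r -> Ival r) /\
    diffeo W Om Hc rc y1 y2 /\
    dprim W Hc (flux2 psi u, fun a b => - flux1 psi u a b) /\
    let xi1 := fun H r => pd1 u (y1 H r) (y2 H r) in
    let xi2 := fun H r => pd2 u (y1 H r) (y2 H r) in
    eq3 p Om xi1 /\ eq3 p Om xi2 /\
    (forall H r, Om H r -> 0 < Jac xi1 xi2 H r) /\
    dprim Om y1 (eps1f p xi2) /\ dprim Om y2 (eps2f p xi1) /\
    dprim Om (fun H r => u (y1 H r) (y2 H r)) (epsf p xi1 xi2).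
Proof.
  intros [HV [Su [Hconv [HJ Heq]]]] Hab0 Hord rc.
  assert (SJ := smooth2_Jdet V u HV Su).
  assert (Src := f_comp_smooth2 V (Jdet u) HV SJ HJ : smooth2 V rc).
  assert (Drc := f_comp_dprim V (Jdet u) SJ HJ : dprim V rc _).
  destruct (smooth2_flux psi V u psi_smooth HV Su HJ) as [SF1 SF2].
  assert (Hdiv := proj1 (eq2_divergence psi V u psi_smooth HV Su HJ) Heq).
  destruct (open2_square_incl V a0 b0 HV Hab0) as [d [Hd HdV]].
  set (Q := square a0 b0 d) in *.
  assert (HQ : open2 Q) by apply open2_square.
  assert (NF1 := smooth2_opp V _ HV SF1).
  destruct (poincare_square a0 b0 d (flux2 psi u, fun a b => - flux1 psi u a b) Hd)
    as [Hc DHc]; cbn [fst snd].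
  { apply (smooth2_subset V _ _ HdV SF2). }
  { apply (smooth2_subset V _ _ HdV NF1). }
  { intros a b Hab; specialize (Hdiv a b (HdV a b Hab)).
    rewrite (dprim_pd1 V _ _ a b (dprim_opp V _ _ (smooth2_dprim V _ SF1)) (HdV a b Hab)).
    cbn [fst snd]; lra. }
  fold Q in DHc.
  assert (SHc : smooth2 Q Hc).
  { apply (dprim_smooth2 Q Hc _ HQ DHc); cbn [fst snd];
      [apply (smooth2_subset V _ _ HdV SF2) | apply (smooth2_subset V _ _ HdV NF1)]. }
  assert (EH : forall a b, Q a b ->
    pd1 Hc a b = p (rc a b) * (pd2 rc a b * pd1 (pd1 u) a b - pd1 rc a b * pd2 (pd1 u) a b) /\
    pd2 Hc a b = p (rc a b) * (pd2 rc a b * pd2 (pd1 u) a b - pd1 rc a b * pd2 (pd2 u) a b)).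
  { intros a b Hab; destruct (flux_eq V u rc a b HV Su HJ eq_refl (HdV a b Hab)) as [F1 F2].
    rewrite (dprim_pd1 Q _ _ a b DHc Hab), (dprim_pd2 Q _ _ a b DHc Hab); cbn [fst snd].
    rewrite F1, F2; split; ring. }
  assert (H11 : forall a b, V a b -> 0 < pd1 (pd1 u) a b).
  { intros a b Hab; apply (strictly_convex_pd11_pos V); auto. }
  assert (HJ' : forall a b, V a b ->
    0 < pd1 (pd1 u) a b * pd2 (pd2 u) a b - pd2 (pd1 u) a b * pd2 (pd1 u) a b).
  { intros a b Hab; specialize (HJ a b Hab); unfold Jdet in HJ.
    rewrite (smooth2_Schwarz V u a b HV Su Hab) in HJ; exact HJ. }
  assert (Hprc : forall a b, V a b -> 0 < p (rc a b)).
  { intros a b Hab; apply p_f_pos, HJ, Hab. }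
  assert (Dpos : forall a b, Q a b -> pd1 rc a b <> 0 \/ pd2 rc a b <> 0 ->
    0 < Jac Hc rc a b).
  { intros a b Hab Hne; unfold Jac; destruct (EH a b Hab) as [-> ->].
    pose proof (HdV a b Hab) as Hv.
    assert (Hq := quadratic_form_pos _ _ _ (pd2 rc a b) (- pd1 rc a b) (H11 a b Hv) (HJ' a b Hv)).
    assert (Hne' : pd2 rc a b <> 0 \/ - pd1 rc a b <> 0) by (destruct Hne; [right | left]; lra).
    apply Hq in Hne'.
    apply (Rmult_lt_compat_l _ _ _ (Hprc a b Hv)) in Hne'.
    lra. }
  assert (HQ0 : Q a0 b0) by (apply square_center, Hd).
  destruct (inverse_function_theorem Q Hc rc a0 b0 HQ HQ0 SHc (smooth2_subset V Q rc HdV Src))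
    as [W [Om [y1 [y2 [HWQ [HW0 Hdiff]]]]]].
  { apply Rgt_not_eq, Dpos; [exact HQ0|].
    rewrite (dprim_pd1 V rc _ a0 b0 Drc Hab0), (dprim_pd2 V rc _ a0 b0 Drc Hab0).
    cbn [fst snd].
    pose proof (sqrt_lt_R0 _ (HJ a0 b0 Hab0)); pose proof (psi_strict _ (HJ a0 b0 Hab0)).
    destruct Hord as [Hn|Hn]; [left | right];
      repeat apply Rmult_integral_contrapositive_currified; try assumption; lra. }
  assert (HWV : subset2 W V) by apply (subset2_trans _ _ _ HWQ HdV).
  destruct (Hdiff) as [HW [HOm [_ [_ [Sy1 [Sy2 [_ HOW]]]]]]].
  assert (Hy : forall H r, Om H r -> V (y1 H r) (y2 H r)).
  { intros H r Hr; apply HWV, HOW, Hr. }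
  assert (HI : forall H r, Om H r -> Ival r).
  { intros H r Hr; destruct (HOW H r Hr) as [_ [_ E]].
    exists (Jdet u (y1 H r) (y2 H r)); split; [apply HJ, Hy, Hr | exact E]. }
  exists W, Om, Hc, y1, y2; split; [exact HWV | split; [exact HW0 | split; [exact HI|]]].
  split; [exact Hdiff | split; [apply (dprim_subset Q W Hc _ HWQ DHc)|]].
  cbv zeta; set (xi1 := fun H r => pd1 u (y1 H r) (y2 H r)).
  set (xi2 := fun H r => pd2 u (y1 H r) (y2 H r)).
  assert (S1 := smooth2_pd1 V u Su); assert (S2 := smooth2_pd2 V u Su).
  assert (Sp := p_smooth2 Om HI).
  assert (Hp : forall H r, Om H r -> 0 < p r).
  { intros H r Hr; destruct (HI H r Hr) as [t [Ht <-]]; apply p_f_pos, Ht. }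
  assert (Sx1 : smooth2 Om xi1) by (apply (smooth2_comp2 Om V (pd1 u)); assumption).
  assert (Sx2 : smooth2 Om xi2) by (apply (smooth2_comp2 Om V (pd2 u)); assumption).
  assert (Dx1 := smooth2_comp2_dprim Om V (pd1 u) y1 y2 HOm HV S1 Sy1 Sy2 Hy : dprim Om xi1 _).
  assert (Dx2 := smooth2_comp2_dprim Om V (pd2 u) y1 y2 HOm HV S2 Sy1 Sy2 Hy : dprim Om xi2 _).
  assert (Key : forall H r, Om H r ->
    0 < Jac xi1 xi2 H r /\
    (pd1 y1 H r = p r * pd2 xi2 H r /\ pd2 y1 H r = - (p r * pd1 xi2 H r)) /\
    (pd1 y2 H r = - (p r * pd2 xi1 H r) /\ pd2 y2 H r = p r * pd1 xi1 H r)).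
  { intros H r Hr.
    destruct (HOW H r Hr) as [HWy [EH1 EH2]].
    assert (P := diffeo_inverse_pd W Om Hc rc y1 y2 _ _ Hdiff HWy).
    cbv zeta in P; rewrite EH1, EH2 in P.
    unfold Jac; rewrite (dprim_pd1 Om _ _ H r Dx1 Hr), (dprim_pd2 Om _ _ H r Dx1 Hr).
    rewrite (dprim_pd1 Om _ _ H r Dx2 Hr), (dprim_pd2 Om _ _ H r Dx2 Hr); cbn [fst snd].
    set (a := y1 H r) in *; set (b := y2 H r) in *.
    assert (Hab : V a b) by apply (Hy H r Hr).
    assert (Hq : Q a b) by apply (HWQ a b HWy).
    assert (DJ : 0 < Jac Hc rc a b).
    { apply Dpos; [exact Hq|].
      destruct (Req_dec (pd1 rc a b) 0) as [E1|E1]; [|left; exact E1].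
      destruct (Req_dec (pd2 rc a b) 0) as [E2|E2]; [|right; exact E2].
      exfalso; apply (proj1 P); unfold Jac; rewrite E1, E2; ring. }
    destruct P as [_ [-> [-> [-> ->]]]].
    rewrite (smooth2_Schwarz V u a b HV Su Hab).
    assert (EP : p r * p r * (pd1 (pd1 u) a b * pd2 (pd2 u) a b
                              - pd2 (pd1 u) a b * pd2 (pd1 u) a b) = 1).
    { assert (P0 := p_f_sqr _ (HJ a b Hab)); fold (rc a b) in P0; rewrite EH2 in P0.
      unfold Jdet in P0; rewrite (smooth2_Schwarz V u a b HV Su Hab) in P0; exact P0. }
    specialize (HJ' a b Hab).
    destruct (EH a b Hq) as [F1 F2]; rewrite EH2 in F1, F2.
    set (D := Jac Hc rc a b) in *.
    assert (ED : D = pd1 Hc a b * pd2 rc a b - pd2 Hc a b * pd1 rc a b) by reflexivity.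
    rewrite F1, F2 in ED |- *.
    set (u11 := pd1 (pd1 u) a b) in *; set (u12 := pd2 (pd1 u) a b) in *.
    set (u22 := pd2 (pd2 u) a b) in *; set (r1 := pd1 rc a b) in *; set (r2 := pd2 rc a b) in *.
    set (P := p r) in *.
    split; [|split; split].
    (* By the chain rule this Jacobian is det(u_ij) / D. The extra factor D is expanded through [ED]
       so that [field] can compare the two sides. *)
    - match goal with |- 0 < ?X =>
        replace X with ((u11 * u22 - u12 * u12) * D / (D * D))
          by (rewrite ED at 1; field; lra) end.
      apply Rdiv_lt_0_compat; apply Rmult_lt_0_compat; lra.
    (* Inserting the factor p^2 J = 1 turns r_2 / D, the H-derivative of x_1, into p times the
       r-derivative of xi_2. *)
    - transitivity ((P * P * (u11 * u22 - u12 * u12)) * (r2 / D));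
        [rewrite EP; ring | field; lra].
    - field; lra.
    - transitivity ((P * P * (u11 * u22 - u12 * u12)) * (- r1 / D));
        [rewrite EP; ring | field; lra].
    - field; lra. }
  assert (Dy1 : dprim Om y1 (eps1f p xi2)).
  { apply (dprim_value Om y1 _ _ (smooth2_dprim Om y1 Sy1)).
    intros H r Hr; apply (Key H r Hr). }
  assert (Dy2 : dprim Om y2 (eps2f p xi1)).
  { apply (dprim_value Om y2 _ _ (smooth2_dprim Om y2 Sy2)).
    intros H r Hr; apply (Key H r Hr). }
  split; [apply (dprim_eps2_eq3 Om xi1 y2); assumption|].
  split; [apply (dprim_eps1_eq3 Om xi2 y1); assumption|].
  split; [intros H r Hr; apply (Key H r Hr)|].
  split; [exact Dy1 | split; [exact Dy2|]].
  apply (dprim_value Om _ _ _ (smooth2_comp2_dprim Om V u y1 y2 HOm HV Su Sy1 Sy2 Hy)).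
  intros H r Hr; cbn [fst snd epsf].
  rewrite (dprim_pd1 Om _ _ H r Dy1 Hr), (dprim_pd2 Om _ _ H r Dy1 Hr).
  rewrite (dprim_pd1 Om _ _ H r Dy2 Hr), (dprim_pd2 Om _ _ H r Dy2 Hr).
  split; reflexivity.
Qed.

(* The gradient of [u] is determined by [epsf], so the potentials are the derivatives
   of [u]; the equations for [y1, y2] then determine the differential of [Hc]. *)
Lemma potentials_unique V u W Om Hc y1 y2 xi1 xi2 :
  open2 V -> smooth2 V u -> (forall x y, V x y -> 0 < Jdet u x y) ->
  subset2 W V ->
  diffeo W Om Hc (fun a b => f (Jdet u a b)) y1 y2 ->
  smooth2 Om xi1 -> smooth2 Om xi2 ->
  dprim Om y1 (eps1f p xi2) -> dprim Om y2 (eps2f p xi1) ->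
  dprim Om (fun H r => u (y1 H r) (y2 H r)) (epsf p xi1 xi2) ->
  (forall H r, Om H r ->
     xi1 H r = pd1 u (y1 H r) (y2 H r) /\ xi2 H r = pd2 u (y1 H r) (y2 H r)) /\
  dprim W Hc (flux2 psi u, fun a b => - flux1 psi u a b).
Proof.
  intros HV Su HJ HWV Hdiff Sx1 Sx2 D1 D2 Du.
  set (rc := fun a b => f (Jdet u a b)) in *.
  destruct (Hdiff) as [HW [HOm [SHc [_ [Sy1 [Sy2 [HWO HOW]]]]]]].
  assert (Hy : forall H r, Om H r -> V (y1 H r) (y2 H r)).
  { intros H r Hr; apply HWV, HOW, Hr. }
  assert (Xi : forall H r, Om H r ->
    pd1 u (y1 H r) (y2 H r) = xi1 H r /\ pd2 u (y1 H r) (y2 H r) = xi2 H r).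
  { intros H r Hr.
    destruct (diffeo_inverse_pd Om W y1 y2 Hc rc H r (diffeo_sym _ _ _ _ _ _ Hdiff) Hr)
      as [HD _].
    assert (C := smooth2_comp2_dprim Om V u y1 y2 HOm HV Su Sy1 Sy2 Hy).
    assert (C1 := dprim_pd1 Om _ _ H r C Hr); assert (C2 := dprim_pd2 Om _ _ H r C Hr).
    rewrite (dprim_pd1 Om _ _ H r Du Hr) in C1; rewrite (dprim_pd2 Om _ _ H r Du Hr) in C2.
    cbn [epsf fst snd] in C1, C2.
    rewrite <- (dprim_pd1 Om _ _ H r D1 Hr), <- (dprim_pd1 Om _ _ H r D2 Hr) in C1.
    rewrite <- (dprim_pd2 Om _ _ H r D1 Hr), <- (dprim_pd2 Om _ _ H r D2 Hr) in C2.
    unfold Jac in HD.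
    set (s1 := pd1 u _ _) in *; set (s2 := pd2 u _ _) in *.
    set (m11 := pd1 y1 H r) in *; set (m12 := pd2 y1 H r) in *.
    set (m21 := pd1 y2 H r) in *; set (m22 := pd2 y2 H r) in *.
    (* Two expressions for the differential of u, by the chain rule and by [epsf], give a linear
       system for grad u - (xi1, xi2) with invertible matrix; Cramer's rule solves it. *)
    split; apply (Rmult_eq_reg_r (m11 * m22 - m12 * m21)); [|exact HD| |exact HD].
    - transitivity (m22 * (s1 * m11 + s2 * m21) - m21 * (s1 * m12 + s2 * m22)); [ring|].
      rewrite <- C1, <- C2; ring.
    - transitivity (m11 * (s1 * m12 + s2 * m22) - m12 * (s1 * m11 + s2 * m21)); [ring|].
      rewrite <- C1, <- C2; ring. }
  split; [intros H r Hr; destruct (Xi H r Hr); split; symmetry; assumption|].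
  assert (S1 := smooth2_pd1 V u Su); assert (S2 := smooth2_pd2 V u Su).
  assert (Dx1 := dprim_ext Om _ xi1 _ HOm (fun H r K => proj1 (Xi H r K))
    (smooth2_comp2_dprim Om V (pd1 u) y1 y2 HOm HV S1 Sy1 Sy2 Hy)).
  assert (Dx2 := dprim_ext Om _ xi2 _ HOm (fun H r K => proj2 (Xi H r K))
    (smooth2_comp2_dprim Om V (pd2 u) y1 y2 HOm HV S2 Sy1 Sy2 Hy)).
  apply (dprim_value W Hc _ _ (smooth2_dprim W Hc SHc)).
  intros a b Hab; cbn [fst snd].
  destruct (flux_eq V u rc a b HV Su HJ eq_refl (HWV a b Hab)) as [F1 F2].
  rewrite F1, F2.
  destruct (HWO a b Hab) as [Hr [Ea Eb]].
  assert (P := diffeo_inverse_pd W Om Hc rc y1 y2 a b Hdiff Hab); cbv zeta in P.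
  set (H := Hc a b) in *; set (r := rc a b) in *.
  destruct P as [HD [P1 [P2 [P3 P4]]]].
  (* After inversion of the coordinate change, the r-derivatives of y1 and y2 are - H_2 / D and H_1
     / D. So the dr components of the two forms determine both derivatives of H. *)
  assert (Q2 := dprim_pd2 Om _ _ H r D1 Hr); assert (Q4 := dprim_pd2 Om _ _ H r D2 Hr).
  cbn [eps1f eps2f fst snd] in Q2, Q4.
  rewrite (dprim_pd1 Om _ _ H r Dx2 Hr) in Q2; rewrite (dprim_pd1 Om _ _ H r Dx1 Hr) in Q4.
  cbn [fst snd] in Q2, Q4.
  rewrite Ea, Eb, P1, P3, P2 in Q2; rewrite Ea, Eb, P1, P3, P4 in Q4.
  rewrite (smooth2_Schwarz V u a b HV Su (HWV a b Hab)) in Q2.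
  set (D := Jac Hc rc a b) in *.
  split.
  - transitivity (pd1 Hc a b / D * D); [field; exact HD|].
    rewrite Q4; field; exact HD.
  - transitivity (- (- pd2 Hc a b / D * D)); [field; exact HD|].
    rewrite Q2; field; exact HD.
Qed.

End Correspondence.

Theorem theorem1
  (psi f p : R -> R)
  (psi_smooth : smooth1 (fun t => 0 < t) psi)
  (psi_strict : forall t, 0 < t -> 0 < der (der psi) t)
  (f_deriv : forall t, 0 < t -> derivable_pt_lim f t (sqrt t * der (der psi) t))
  (p_def : forall t, 0 < t -> p (f t) = / sqrt t) :
  let I := fun r => exists t, 0 < t /\ f t = r in
  (* ---------- part (a) ---------- *)
  (forall (Om : R -> R -> Prop) (H0 r0 : R) (xi1 xi2 : R -> R -> R),
     open2 Om -> Om H0 r0 -> (forall H r, Om H r -> I r) ->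
     eq3 p Om xi1 -> eq3 p Om xi2 -> 0 < Jac xi1 xi2 H0 r0 ->
     exists Om1 : R -> R -> Prop,
       open2 Om1 /\ Om1 H0 r0 /\ subset2 Om1 Om /\
       closed_on Om1 (epsf p xi1 xi2) /\ closed_on Om1 (eps1f p xi2) /\
       closed_on Om1 (eps2f p xi1) /\
       wedge_nonvanishing Om1 (eps1f p xi2) (eps2f p xi1) /\
       (exists u x1 x2 : R -> R -> R,
          dprim Om1 u (epsf p xi1 xi2) /\ dprim Om1 x1 (eps1f p xi2) /\
          dprim Om1 x2 (eps2f p xi1)) /\
       (forall u x1 x2 : R -> R -> R,
          dprim Om1 u (epsf p xi1 xi2) -> dprim Om1 x1 (eps1f p xi2) ->
          dprim Om1 x2 (eps2f p xi1) ->
          exists (Om2 V : R -> R -> Prop) (y1 y2 : R -> R -> R),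
            subset2 Om2 Om1 /\ Om2 H0 r0 /\ diffeo Om2 V x1 x2 y1 y2 /\
            let U := fun a b => u (y1 a b) (y2 a b) in
            sol2 psi V U /\
            (forall a b, V a b ->
               pd1 U a b = xi1 (y1 a b) (y2 a b) /\
               pd2 U a b = xi2 (y1 a b) (y2 a b)) /\
            (forall a b, V a b -> ordinary U a b)))
  /\
  (* ---------- part (b) ---------- *)
  (forall (V : R -> R -> Prop) (u : R -> R -> R) (a0 b0 : R),
     sol2 psi V u -> V a0 b0 -> ordinary u a0 b0 ->
     let rc := fun a b => f (Jdet u a b) in
     exists (W Om : R -> R -> Prop) (Hc y1 y2 : R -> R -> R),
       subset2 W V /\ W a0 b0 /\ (forall H r, Om H r -> I r) /\
       diffeo W Om Hc rc y1 y2 /\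
       let xi1 := fun H r => pd1 u (y1 H r) (y2 H r) in
       let xi2 := fun H r => pd2 u (y1 H r) (y2 H r) in
       eq3 p Om xi1 /\ eq3 p Om xi2 /\
       (forall H r, Om H r -> 0 < Jac xi1 xi2 H r) /\
       dprim Om y1 (eps1f p xi2) /\ dprim Om y2 (eps2f p xi1) /\
       dprim Om (fun H r => u (y1 H r) (y2 H r)) (epsf p xi1 xi2) /\
       (* uniqueness *)
       (forall (W' Om' : R -> R -> Prop) (Hc' y1' y2' xi1' xi2' : R -> R -> R),
          subset2 W' V -> W' a0 b0 -> (forall H r, Om' H r -> I r) ->
          diffeo W' Om' Hc' rc y1' y2' ->
          eq3 p Om' xi1' -> eq3 p Om' xi2' ->
          (forall H r, Om' H r -> 0 < Jac xi1' xi2' H r) ->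
          dprim Om' y1' (eps1f p xi2') -> dprim Om' y2' (eps2f p xi1') ->
          dprim Om' (fun H r => u (y1' H r) (y2' H r)) (epsf p xi1' xi2') ->
          exists (c k1 k2 : R) (W'' : R -> R -> Prop),
            open2 W'' /\ W'' a0 b0 /\ subset2 W'' W /\ subset2 W'' W' /\
            forall a b, W'' a b ->
              Hc' a b = Hc a b + c /\
              xi1' (Hc' a b) (rc a b) = xi1 (Hc' a b - c) (rc a b) + k1 /\
              xi2' (Hc' a b) (rc a b) = xi2 (Hc' a b - c) (rc a b) + k2)).
Proof.
  intros I.
  split.
  - intros Om H0 r0 xi1 xi2 HO HOm HI E1 E2 HJ0.
    destruct (E1) as [S1 _]; destruct (E2) as [S2 _].
    (* The domain is shrunk to a square, where the Poincaré lemma applies, on which the Jacobian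
       stays positive. *)
    destruct (cont2_pos_square Om (Jac xi1 xi2) H0 r0 HO) as [d [Hd [Hsub HJ]]]; auto.
    { apply smooth2_cont, smooth2_Jac; assumption. }
    set (Om1 := square H0 r0 d) in *.
    assert (HO1 : open2 Om1) by apply open2_square.
    assert (HI1 : forall H r, Om1 H r -> I r) by (intros H r Hr; apply (HI H), Hsub, Hr).
    assert (Sp := p_smooth2 psi f p psi_smooth psi_strict f_deriv p_def Om1 HI1).
    assert (Hp : forall H r, Om1 H r -> 0 < p r).
    { intros H r Hr; destruct (HI1 H r Hr) as [t [Ht <-]]; apply (p_f_pos f p p_def), Ht. }
    apply (smooth2_subset _ _ _ Hsub) in S1; apply (smooth2_subset _ _ _ Hsub) in S2.
    assert (E1' : eq3 p Om1 xi1) by (split; [exact S1|]; intros H r Hr; apply E1, Hsub, Hr).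
    assert (E2' : eq3 p Om1 xi2) by (split; [exact S2|]; intros H r Hr; apply E2, Hsub, Hr).
    assert (C := eps_closed p Om1 xi1 xi2 HO1 Sp Hp E1' E2').
    assert (C1 := eps1_closed p Om1 xi2 HO1 Sp Hp E2').
    assert (C2 := eps2_closed p Om1 xi1 HO1 Sp Hp E1').
    exists Om1; split; [exact HO1 | split; [apply square_center, Hd | split; [exact Hsub|]]].
    split; [exact C | split; [exact C1 | split; [exact C2 | split; [|split]]]].
    + intros H r Hr; rewrite eps_wedge.
      specialize (Hp H r Hr); specialize (HJ H r Hr).
      apply Rgt_not_eq; repeat apply Rmult_lt_0_compat; assumption.
    + destruct (eps_smooth2 p Om1 xi1 xi2 HO1 Sp S1 S2).
      destruct (eps1_smooth2 p Om1 xi2 HO1 Sp S2), (eps2_smooth2 p Om1 xi1 HO1 Sp S1).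
      destruct (poincare_square H0 r0 d (epsf p xi1 xi2)) as [u Du]; auto; [apply C|].
      destruct (poincare_square H0 r0 d (eps1f p xi2)) as [x1 D1]; auto; [apply C1|].
      destruct (poincare_square H0 r0 d (eps2f p xi1)) as [x2 D2]; auto; [apply C2|].
      exists u, x1, x2; auto.
    + intros u x1 x2 Du D1 D2.
      apply (solution_from_potentials psi f p psi_smooth psi_strict f_deriv p_def Om1);
        auto; apply square_center, Hd.
  - intros V u a0 b0 Hsol Hab0 Hord rc.
    destruct (potentials_from_solution psi f p psi_smooth psi_strict f_deriv p_def V u a0 b0
                Hsol Hab0 Hord) as [W [Om [Hc [y1 [y2 Hall]]]]].
    destruct Hall as [HWV [HW0 [HI [Hdiff [DHc Hxi]]]]].
    exists W, Om, Hc, y1, y2.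
    split; [exact HWV | split; [exact HW0 | split; [exact HI | split; [exact Hdiff|]]]].
    cbv zeta; set (xi1 := fun H r => pd1 u (y1 H r) (y2 H r)).
    set (xi2 := fun H r => pd2 u (y1 H r) (y2 H r)); destruct Hxi as [E1 [E2 [HJ [D1 [D2 Du]]]]].
    split; [exact E1 | split; [exact E2 | split; [exact HJ|]]].
    split; [exact D1 | split; [exact D2 | split; [exact Du|]]].
    intros W' Om' Hc' y1' y2' xi1' xi2' HWV' HW0' _ Hdiff' [S1' _] [S2' _] _ D1' D2' Du'.
    destruct Hsol as [HV [Su [_ [HJu _]]]].
    destruct (potentials_unique psi f p f_deriv p_def V u W' Om' Hc' y1' y2' xi1' xi2'
                HV Su HJu HWV' Hdiff' S1' S2' D1' D2' Du') as [Xi' DHc'].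
    destruct Hdiff as [HW [_ [_ [_ [_ [_ [HWO _]]]]]]].
    destruct Hdiff' as [HW' [_ [_ [_ [_ [_ [HWO' _]]]]]]].
    destruct (open2_square_incl _ a0 b0 (open2_inter W W' HW HW') (conj HW0 HW0'))
      as [d [Hd Hsub]].
    (* Both Hc and Hc' have the differential prescribed by u, so on a square inside W and W' they
       differ by their difference at (a0, b0). The additive constants are 0 because both pairs of
       potentials are the gradient of the same u. *)
    exists (Hc' a0 b0 - Hc a0 b0), 0, 0, (square a0 b0 d).
    split; [apply open2_square | split; [apply square_center, Hd | split; [|split]]].
    + intros a b Hab; apply (Hsub a b Hab).
    + intros a b Hab; apply (Hsub a b Hab).
    + intros a b Hab; destruct (Hsub a b Hab) as [Ha Ha'].
      assert (Hconst : Hc' a b - Hc a b = Hc' a0 b0 - Hc a0 b0).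
      { apply (dprim_zero_square a0 b0 d (fun a b => Hc' a b - Hc a b)); [|exact Hab].
        apply (dprim_value _ _ _ _ (dprim_minus _ _ _ _ _
          (dprim_subset W' _ Hc' _ (fun x y H => proj2 (Hsub x y H)) DHc')
          (dprim_subset W _ Hc _ (fun x y H => proj1 (Hsub x y H)) DHc))).
        intros x y _; cbn [fst snd]; split; ring. }
      split; [lra|].
      replace (Hc' a b - (Hc' a0 b0 - Hc a0 b0)) with (Hc a b) by lra.
      destruct (HWO a b Ha) as [_ [Y1 Y2]]; destruct (HWO' a b Ha') as [HO' [Y1' Y2']].
      destruct (Xi' _ _ HO') as [X1 X2].
      fold (rc a b) in Y1, Y2, Y1', Y2', HO', X1, X2.
      unfold xi1, xi2; rewrite X1, X2, Y1, Y2, Y1', Y2'; split; ring.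
Qed.
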